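(* Let $\mathcal{U}$ be a small category and let $\mathcal{A}$ be a $k$-quiver on $\mathcal{U}$. An element $\alpha=(m,f,c)\in (s^{-1}\mathbf{C}_{GS}(\mathcal{A}))_1=\mathbf{C}_{GS}^{0,2}(\mathcal{A})\oplus\mathbf{C}_{GS}^{1,1}(\mathcal{A})\oplus\mathbf{C}_{GS}^{2,0}(\mathcal{A})$ is a Maurer–Cartan element of $s^{-1}\mathbf{C}_{GS}(\mathcal{A})$ if and only if $(\mathcal{A},m,f,c)$ is a lax prestack.
   Context: $k$ is a commutative ring, $\mathbb{N}=\{0,1,2,\dots\}$. Operads are symmetric, possibly coloured, with partial compositions $\circ_i$, full compositions, right symmetric group actions; $x\circ(-,x_2,\dots,x_n)$ means that the first input is left uncomposed; $1$ denotes operadic identities. **The operad $\square\mathsf{p}$ and box operads.** $\square\mathsf{p}$ is the $\mathbb{N}^3$-coloured symmetric operad in sets generated by: for all $n\ge 0$ and $q_1,\dots,q_n,p_0,\dots,p_n,p,r\in\mathbb{N}$ an element $C^{p_0,\dots,p_n;p,r}_{q_1,\dots,q_n}\in\square\mathsf{p}((p,n,r),(p_0,q_1,p_1),\dots,(p_{n-1},q_n,p_n);(p+p_0,\sum_{i} q_i,r+p_n))$ and $\eta\in\square\mathsf{p}(\,;(0,1,0))$, subject to unit relations $C^{p,r;0,0}_{q}\circ_1\eta=1$, $C^{0,\dots,0;p,r}_{1,\dots,1}\circ(-,\eta,\dots,\eta)=1$ and to the associativity relations expressing, on algebras, that with $\mu(x;x_1,\dots,x_n)$ the operation of $C$ one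 has $\mu(\mu(x;x_1,\dots,x_n);x_1^1,\dots,x^n_{m_n})=\mu(x;\mu(x_1;x^1_1,\dots,x^1_{m_1}),\dots,\mu(x_n;x^n_1,\dots,x^n_{m_n}))$ for $x,x_i,x^i_j$ of colours $(p,n,r)$, $(p_{i-1},m_i,p_i)$, $(p^i_{j-1},q^i_j,p^i_j)$ with $p^i_{m_i}=p^{i+1}_0$ for $0<i<n$ (if $m_i=0$, a number $p^i_0$ is still part of the data). A (linear) box operad $\mathcal{B}$ is an algebra over the linearisation $k\square\mathsf{p}$: $k$-modules $\mathcal{B}(p,q,r)$, composition maps $\mathcal{B}(p,n,r)\otimes\bigotimes_i\mathcal{B}(p_{i-1},q_i,p_i)\to\mathcal{B}(p+p_0,\sum q_i,r+p_n)$ (one for each $p_0$ if $n=0$), and a unit in $\mathcal{B}(0,1,0)$, satisfying these axioms. An element $S$ of $\square\mathsf{p}$ with $n$ inputs is called a stacking of $n$ boxes, its input colours $(p_i,q_i,r_i)$ being its boxes. **Types, standard order, graph.** A box $(p,q,r)$ is thin if $p=r=0$; semi-thin if $(p,r)\ne(0,0)$ and ($p=0$ or $r=0$); non-thin otherwise. The stackings in standard order are the smallest collection containing operadic identities and $\eta$, and containing $C\circ(-,S_1,\dots,S_n)$, for $C$ a generator, whenever it contains $S_1,\dots,S_n$ ($n\ge0$). The horizontal composite graph $\mathbb{H}_S$ has vertices the boxes of $S$, vertex $i$ having $p_i$ ordered inputs and $r_i$ ordered outputs, and is determined by: the identity gives a single vertex; $\eta$ gives the empty graph; $C^{p_0,\dots,p_n;p,r}_{q_1,\dots,q_n}$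 gives the disjoint juxtaposition of vertex 1 (first) with the serial composite of vertices $2,\dots,n+1$ (the $j$-th output of each joined to the $j$-th input of the next; for $n=0$, $p_0$ wires joining inputs directly to outputs); composition corresponds to substitution of graphs in vertices. Vertices without edges and wires without vertices count as connected components. **Signs and braces.** $\mathrm{td}(p,q,r)=p-r+q$ if $(p,r)\neq(0,0)$, $\mathrm{td}(0,q,0)=q-1$; $\mathrm{d}(p,q,r)=p-r+q-1$. For a stacking $S$ with output $(p,q,r)$, $|S^{\mathrm{td}}|=\mathrm{td}(p,q,r)-\sum_i\mathrm{td}(p_i,q_i,r_i)$. The sign $(-1)^{S^{\mathrm d}}$ is determined by: $(-1)^{\eta}=1$; for $C^{p_0,\dots,p_n;p,r}_{q_1,\dots,q_n}$ it is $(-1)^{(p_0+p_n)r+\sum_i(q_i-1)(n-i)+\sum_i(q_i-1)(p-r+p_0-p_{i-1})}$; it is multiplicative under $\circ_i$; and $(-1)^{(S^\sigma)^{\mathrm d}}=(-1)^{S^{\mathrm d}}$ times the Koszul sign of permuting elements of degrees $\mathrm{d}(p_i,q_i,r_i)$. Put $(-1)^{S^{\mathrm{td}}}=(-1)^{S^{\mathrm d}+n+\sum_{t=1}^n\mathrm{td}(p_t,q_t,r_t)N_t}$, with $N_t$ the number of non-thin boxes of index $>t$. $S$ (with $n$ boxes) is thin-quadratic if $|S^{\mathrm{td}}|=2-n$, $S$ is in standard order, $\mathbb{H}_S$ has exactly two connected components and $S$ has no semi-thin boxes. **The operations on a box operad.** $\mathrm{Tot}(s^{-1}_{\mathrm{thin}}\mathcal{B})$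 is the graded $k$-module with degree $n$ part $\prod_{\mathrm{td}(p,q,r)=n}\mathcal{B}(p,q,r)$; $\theta\in\mathcal{B}(p,q,r)$ is written $\theta^{\mathrm{td}}$ there. For $\theta_i\in\mathcal{B}(p_i,q_i,r_i)$ put $$S^{\mathrm{td}}(\theta_1^{\mathrm{td}},\dots,\theta_n^{\mathrm{td}})=(-1)^{\frac{|S^{\mathrm{td}}|(|S^{\mathrm{td}}|+1)}2+|S^{\mathrm{td}}|\mathrm{td}(p,q,r)+\sum_i|\theta_i^{\mathrm{td}}|\sum_{j>i}\mathrm{td}(p_j,q_j,r_j)}S(\theta_1,\dots,\theta_n)^{\mathrm{td}},$$ and $P_n=\sum_S(-1)^{S^{\mathrm{td}}}S^{\mathrm{td}}$, the sum being over all thin-quadratic stackings of $n$ boxes, extended to the product. $P_n$ has degree $2-n$. **The Gerstenhaber–Schack box operad.** A $k$-quiver $\mathcal{A}$ on $\mathcal{U}$ consists of: for each object $U$ of $\mathcal{U}$ a $k$-quiver $\mathcal{A}(U)$ (a set of objects $\mathrm{Ob}(\mathcal{A}(U))$ and $k$-modules $\mathcal{A}(U)(A,A')$), and for each $u:V\to U$ a function $u^*:\mathrm{Ob}(\mathcal{A}(U))\to\mathrm{Ob}(\mathcal{A}(V))$ (no further conditions). For a $p$-simplex $\sigma=(U_0\xrightarrow{u_1}\cdots\xrightarrow{u_p}U_p)$ of $\mathcal{U}$ put $\sigma^*=u_1^*\circ\cdots\circ u_p^*$ (identity if $p=0$). $\Delta^{inj}_f(r,p)$ is the set of strictly increasing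 maps $f:[r]\to[p]$, $[n]=\{0,\dots,n\}$, with $f(0)=0$, $f(r)=p$; $f(\sigma)$ is the $r$-simplex $U_{f(0)}\to U_{f(1)}\to\cdots\to U_{f(r)}$ with composed arrows. For $p\ge r$, $$\mathbf{C}_\square^{p,q,r}(\mathcal{A})=\prod_{\sigma,\ f\in\Delta^{inj}_f(r,p)}\ \prod_{A_0,\dots,A_q\in\mathcal{A}(U)}\mathrm{Hom}_k\Big(\bigotimes_{i=1}^q\mathcal{A}(U)(A_{i-1},A_i),\mathcal{A}(V)(\sigma^*A_0,f(\sigma)^*A_q)\Big),$$ with $\sigma$ ranging over $p$-simplices, $V=U_0$, $U=U_p$; it is $0$ for $p<r$. For $\theta\in\mathbf{C}_\square^{p,q,r}$, $\theta'\in\mathbf{C}_\square^{r,q',t}$, put $(\theta\otimes_{\mathcal{A}}\theta')^{\sigma,f}_{(A_0,\dots,A_{q+q'})}=\sum_{f=f_1\circ f_2}\theta^{\sigma,f_1}_{(A_0,\dots,A_q)}\otimes\theta'^{f_1(\sigma),f_2}_{(A_q,\dots,A_{q+q'})}$ ($f_1\in\Delta_f^{inj}(r,p)$, $f_2\in\Delta^{inj}_f(t,r)$), and iterate. The composition is: for $\sigma$ a $(p+p_0)$-simplex and $f\in\Delta^{inj}_f(r+p_n,p+p_0)$ with $f(r)=p$, $(\theta\circ(\theta_1,\dots,\theta_n))^{\sigma,f}=\theta^{\sigma_{\le p},f_{\le r}}\circ(\theta_1\otimes_{\mathcal{A}}\cdots\otimes_{\mathcal{A}}\theta_n)^{\sigma_{>p},f_{>r}}$,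 and $0$ if $f(r)\ne p$; here $\sigma_{\le p}$ consists of the first $p$ arrows, $\sigma_{>p}$ of the remaining $p_0$ arrows, $f_{\le r}$ is the restriction of $f$ to $[r]$, and $f_{>r}(j)=f(r+j)-p$ (for $n=0$ the empty tensor is trivial and $f_{>r}=\mathrm{id}$). The unit is the identity in $\mathbf{C}_\square^{0,1,0}(\mathcal{A})$. This is a box operad. **The Gerstenhaber–Schack object.** $\mathbf{C}_{GS}^{0,q}(\mathcal{A})=\mathbf{C}_\square^{0,q,0}(\mathcal{A})$, $\mathbf{C}_{GS}^{p,q}(\mathcal{A})=\mathbf{C}_\square^{p,q,1}(\mathcal{A})$ for $p\ge1$, $\mathbf{C}_{GS}^n(\mathcal{A})=\bigoplus_{p+q=n}\mathbf{C}^{p,q}_{GS}(\mathcal{A})$; $s^{-1}\mathbf{C}_{GS}(\mathcal{A})$ has degree $n$ part $\mathbf{C}^{n+1}_{GS}(\mathcal{A})$ and is a graded submodule of $\mathrm{Tot}(s^{-1}_{\mathrm{thin}}\mathbf{C}_\square(\mathcal{A}))$ closed under the $P_n$. **Maurer–Cartan elements.** A degree 1 element $\alpha$ is Maurer–Cartan if $\sum_{n\ge2}(-1)^{n(n+1)/2}P_n(\alpha,\dots,\alpha)=0$. Since $P_n(\alpha,\dots,\alpha)=0$ for $n\ge5$ and every degree 1 element $\alpha$ of $s^{-1}\mathbf{C}_{GS}(\mathcal{A})$, this reads $-P_2(\alpha,\alpha)+P_3(\alpha,\alpha,\alpha)+P_4(\alpha,\alpha,\alpha,\alpha)=0$. **Lax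 prestacks.** A lax prestack $(\mathcal{A},m,f,c)$ over $\mathcal{U}$ consists of the following data: for every object $U$ of $\mathcal{U}$, a $k$-linear category $(\mathcal{A}(U),m^U)$, where $m^U$ is the composition of morphisms in $\mathcal{A}(U)$; for every morphism $u:V\to U$ in $\mathcal{U}$, a $k$-linear functor $f^u=u^*:\mathcal{A}(U)\to\mathcal{A}(V)$ (the restrictions); for every pair of morphisms $v:W\to V$, $u:V\to U$ in $\mathcal{U}$, a $k$-linear natural transformation $c^{u,v}:v^*u^*\to(uv)^*$ (the twists); such that for every triple $w:T\to W$, $v:W\to V$, $u:V\to U$: $c^{u,vw}(c^{v,w}\circ u^* )=c^{uv,w}(w^*\circ c^{u,v})$. A lax prestack has an underlying quiver on $\mathcal{U}$ (in the claim this is the given $\mathcal{A}$, so $f^u$ is given on objects by the function $u^*$), and the triple $(m,f,c)$ corresponds to an element of $\mathbf{C}^2_{GS}(\mathcal{A})$: the data $m^U_{A_0,A_1,A_2}:\mathcal{A}(U)(A_0,A_1)\otimes\mathcal{A}(U)(A_1,A_2)\to\mathcal{A}(U)(A_0,A_2)$, $f^u_{A_0,A_1}:\mathcal{A}(U)(A_0,A_1)\to\mathcal{A}(V)(u^*A_0,u^*A_1)$, $c^{u,v}_A\in\mathcal{A}(W)(v^*u^*A,(uv)^*A)$ lie in $\mathbf{C}_{GS}^{0,2}$, $\mathbf{C}_{GS}^{1,1}$, $\mathbf{C}_{GS}^{2,0}$ respectively.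
   Formalization: The k-linear categories and functors of a lax prestack are taken non-unital (no identity morphisms required or preserved); with identities the claim fails, e.g. α = 0 on a quiver with a nonzero hom module is Maurer–Cartan but m = 0 has no identities. *)

(* Defs.v *)
From HB Require Import structures.
From mathcomp Require Import all_boot all_order all_algebra.
From mathcomp Require Import boolp classical_sets cardinality fsbigop.

Set Implicit Arguments.
Unset Strict Implicit.
Unset Printing Implicit Defensive.

Import GRing.Theory.
Local Open Scope ring_scope.
Local Open Scope quotient_scope.

(** * Generalities *)

(** Paths [X_0 -> X_1 -> ... -> X_n] in a quiver. *)
Inductive qpath (T : Type) (H : T -> T -> Type) : T -> T -> Type :=
| pnil X : qpath H X X
| pcons X Y Z : H X Y -> qpath H Y Z -> qpath H X Z.
Arguments pnil {T H} X.
Arguments pcons {T H X Y Z} _ _.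

Section Paths.
Variables (T : Type) (H : T -> T -> Type).

Fixpoint psize X Y (s : qpath H X Y) : nat :=
  match s with pnil _ => 0 | pcons _ _ _ _ s' => (psize s').+1 end.

Fixpoint pcat X Y Z (s : qpath H X Y) : qpath H Y Z -> qpath H X Z :=
  match s in qpath _ X Y return qpath H Y Z -> qpath H X Z with
  | pnil _ => id
  | pcons _ _ _ u s' => fun t => pcons u (pcat s' t)
  end.

Fact psize_cat X Y Z (s : qpath H X Y) (t : qpath H Y Z) :
  psize (pcat s t) = (psize s + psize t)%N.
Proof. by elim: s t => //= ? ? ? ? ? IH t; rewrite IH addSn. Qed.

(** The first [n] arrows of a path, and the remaining ones. *)
Fixpoint psplit (n : nat) X Z (s : qpath H X Z) {struct s} :
    {Y : T & (qpath H X Y * qpath H Y Z)%type} :=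
  match s in qpath _ X Z return {Y : T & (qpath H X Y * qpath H Y Z)%type} with
  | pnil X => existT _ X (pnil X, pnil X)
  | pcons X _ _ u s' =>
    if n is n'.+1 then
      let: existT Y st := psplit n' s' in existT _ Y (pcons u st.1, st.2)
    else existT _ X (pnil X, pcons u s')
  end.

End Paths.

Section DependentProduct.
Variables (k : pzRingType) (I : Type) (V : I -> lmodType k).

Definition dprod : Type := forall i, V i.
Implicit Types x y : dprod.

HB.instance Definition _ := gen_eqMixin dprod.
HB.instance Definition _ := gen_choiceMixin dprod.

Definition dprod_add x y : dprod := fun i => x i + y i.
Definition dprod_opp x : dprod := fun i => - x i.
Definition dprod_scale (a : k) x : dprod := fun i => a *: x i.

Fact dprod_addA : associative dprod_add.
Proof. by move=> x y z; apply: functional_extensionality_dep => i; apply: addrA. Qed.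
Fact dprod_addC : commutative dprod_add.
Proof. by move=> x y; apply: functional_extensionality_dep => i; apply: addrC. Qed.
Fact dprod_add0 : left_id ((fun=> 0) : dprod) dprod_add.
Proof. by move=> x; apply: functional_extensionality_dep => i; apply: add0r. Qed.
Fact dprod_addN : left_inverse ((fun=> 0) : dprod) dprod_opp dprod_add.
Proof. by move=> x; apply: functional_extensionality_dep => i; apply: addNr. Qed.

HB.instance Definition _ :=
  GRing.isZmodule.Build dprod dprod_addA dprod_addC dprod_add0 dprod_addN.

Fact dprod_scaleA a b x : dprod_scale a (dprod_scale b x) = dprod_scale (a * b) x.
Proof. by apply: functional_extensionality_dep => i; apply: scalerA. Qed.
Fact dprod_scale1 : left_id 1 dprod_scale.
Proof. by move=> x; apply: functional_extensionality_dep => i; apply: scale1r. Qed.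
Fact dprod_scaleDr : right_distributive dprod_scale +%R.
Proof. by move=> a x y; apply: functional_extensionality_dep => i; apply: scalerDr. Qed.
Fact dprod_scaleDl x : {morph dprod_scale^~ x : a b / a + b}.
Proof. by move=> a b; apply: functional_extensionality_dep => i; apply: scalerDl. Qed.

HB.instance Definition _ := GRing.Zmodule_isLmodule.Build k dprod
  dprod_scaleA dprod_scale1 dprod_scaleDr dprod_scaleDl.

End DependentProduct.

(** * The operad of box stackings *)

(** The colour [(p, q, r)]. *)
Definition colour : Type := (nat * nat * nat)%type.

(** The generator [C^{p_0,...,p_n;p,r}_{q_1,...,q_n}] is encoded by [p], [r],
    [p_0] and the list [(q_1, p_1), ..., (q_n, p_n)]. *)
Record gen := Gen { gp : nat; gr : nat; gp0 : nat; gl : seq (nat * nat) }.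

(** The colours [(p_0, q_1, p_1), (p_1, q_2, p_2), ...]. *)
Fixpoint chain_colours (p0 : nat) (l : seq (nat * nat)) : seq colour :=
  if l is (q, p) :: l' then (p0, q, p) :: chain_colours p l' else [::].

Definition gar (g : gen) : nat := size (gl g).
Definition gpn (g : gen) : nat := last (gp0 g) (unzip2 (gl g)).
Definition ghead (g : gen) : colour := (gp g, gar g, gr g).
Definition gin (g : gen) : seq colour := ghead g :: chain_colours (gp0 g) (gl g).
Definition gout (g : gen) : colour :=
  (gp g + gp0 g, sumn (unzip1 (gl g)), gr g + gpn g)%N.

(** Operadic composites of the generators and of [eta]; [Var i X] is the [i]-th
    input (counted from [0]), of colour [X]. *)
Inductive term :=
| Var of nat & colour
| Eta
| App of gen & seq term.

HB.instance Definition _ := gen_eqMixin term.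
HB.instance Definition _ := gen_choiceMixin term.

Definition out (t : term) : colour :=
  match t with Var _ X => X | Eta => (0, 1, 0)%N | App g _ => gout g end.

Fixpoint typed (t : term) : bool :=
  if t is App g ts then (map out ts == gin g) && all typed ts else true.

(** The inputs in planar order, with their indices. *)
Fixpoint leaves (t : term) : seq (nat * colour) :=
  match t with
  | Var i X => [:: (i, X)]
  | Eta => [::]
  | App _ ts => flatten (map leaves ts)
  end.

Definition nboxes (t : term) : nat := size (leaves t).

(** Elements of the free symmetric operad: each input occurs exactly once. *)
Definition wf (t : term) : bool :=
  typed t && perm_eq (unzip1 (leaves t)) (iota 0 (nboxes t)).

(** The congruence generated by the unit and associativity relations.  In
    [teq_assoc] the list [ws] consists of the triples of the generator applied to
    [x_i], of [x_i], and of the [x^i_j]; typing and the equality of the output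
    colours determine the indices [p_i], [p^i_j], [q^i_j] of the generators as in
    the associativity relation. *)
Inductive teq : term -> term -> Prop :=
| teq_refl t : teq t t
| teq_sym s t : teq s t -> teq t s
| teq_trans s t u : teq s t -> teq t u -> teq s u
| teq_ctx g ts ts' s t : teq s t -> teq (App g (ts ++ s :: ts')) (App g (ts ++ t :: ts'))
| teq_unitl p q r t : typed t -> out t = (p, q, r) ->
    teq (App (Gen 0 0 p [:: (q, r)]) [:: Eta; t]) t
| teq_unitr p n r t : typed t -> out t = (p, n, r) ->
    teq (App (Gen p r 0 (nseq n (1, 0)%N)) (t :: nseq n Eta)) t
| teq_assoc g h g' x (ws : seq (gen * term * seq term)) :
    let lhs := App g (App h (x :: [seq w.1.2 | w <- ws]) :: flatten [seq w.2 | w <- ws]) in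
    let rhs := App g' (x :: [seq App w.1.1 (w.1.2 :: w.2) | w <- ws]) in
    typed lhs -> typed rhs -> out lhs = out rhs -> teq lhs rhs.

Record wterm := WTerm { wval :> term; wvalP : wf wval }.
HB.instance Definition _ := [isSub for wval].
HB.instance Definition _ := [Choice of wterm by <:].

Definition wteq : rel wterm := fun s t => `[< teq s t >].

Fact wteq_refl : reflexive wteq.
Proof. by move=> t; apply/asboolP; apply: teq_refl. Qed.
Fact wteq_sym : symmetric wteq.
Proof. by move=> s t; apply/asboolP/asboolP; apply: teq_sym. Qed.
Fact wteq_trans : transitive wteq.
Proof. by move=> s t u /asboolP st /asboolP tu; apply/asboolP; apply: teq_trans tu. Qed.

Canonical wteq_equiv := EquivRel wteq wteq_refl wteq_sym wteq_trans.

(** All elements, of all profiles, of the operad of stackings. *)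
Definition stacking : Type := {eq_quot wteq}.
HB.instance Definition _ := Choice.on stacking.
HB.instance Definition _ := Quotient.on stacking.

(** Terms of stackings in standard order, with inputs numbered from [k] on:
    operadic identities, [eta], and [C o (-, S_1, ..., S_n)]. *)
Inductive std : nat -> term -> Prop :=
| std_id k X : std k (Var k X)
| std_eta k : std k Eta
| std_app k g X ts : std_seq k.+1 ts -> std k (App g (Var k X :: ts))
with std_seq : nat -> seq term -> Prop :=
| std_nil k : std_seq k [::]
| std_cons k t ts : std k t -> std_seq (k + nboxes t) ts -> std_seq k (t :: ts).

Definition std_term_of (S : stacking) (t : wterm) : Prop := std 0 t /\ \pi_stacking t = S.
Definition standard_order (S : stacking) : Prop := exists t, std_term_of S t.

(** Notions invariant under the relations are computed on a representative, which
    for a stacking in standard order is chosen among its standard order terms. *)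
Definition term_of (S : stacking) : term :=
  match pselect (standard_order S) with
  | left e => sval (cid e)
  | right _ => repr S
  end.

(** ** Types of boxes, horizontal composite graph *)

Definition thin (X : colour) : bool := let: (p, _, r) := X in (p == 0) && (r == 0).
Definition semi_thin (X : colour) : bool :=
  let: (p, _, r) := X in ~~ thin X && ((p == 0) || (r == 0)).
Definition non_thin (X : colour) : bool := ~~ thin X && ~~ semi_thin X.

(** A graph with ordered inputs and outputs is given by its list of oriented edges.
    A port [(Some i, j)] is the [j]-th output (as source) or input (as target) of
    the vertex [i]; [(None, j)] is the [j]-th input (as source) or output (as
    target) of the whole graph. *)
Definition port : Type := (option nat * nat)%type.
Definition hgraph : Type := seq (port * port).

Definition hvertex (i : nat) (X : colour) : hgraph :=
  let: (p, _, r) := X in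
  [seq ((None, j), (Some i, j)) | j <- iota 0 p]
  ++ [seq ((Some i, j), (None, j)) | j <- iota 0 r].

Definition hwires (p : nat) : hgraph := [seq ((None, j), (None, j)) | j <- iota 0 p].

Definition port_shift (m : nat) (x : port) : port :=
  if x.1 is Some _ then x else (None, (m + x.2)%N).

(** [G] has [p] inputs and [r] outputs. *)
Definition hjuxtapose (p r : nat) (G G' : hgraph) : hgraph :=
  G ++ [seq (port_shift p e.1, port_shift r e.2) | e <- G'].

(** The outputs of [G] are joined to the inputs of [G']. *)
Definition hserial (G G' : hgraph) : hgraph :=
  [seq e <- G | isSome e.2.1]
  ++ [seq e <- G' | isSome e.1.1]
  ++ [seq (ee.1.1, ee.2.2) |
       ee <- [seq (e, e') | e <- G, e' <- G'] & (ee.1.2.1 == None) && (ee.1.2 == ee.2.1)].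

Fixpoint horizontal (t : term) : hgraph :=
  match t with
  | Var i X => hvertex i X
  | Eta => [::]
  | App g ts =>
    let Gs := map horizontal ts in
    hjuxtapose (gp g) (gr g) (head [::] Gs) (foldl hserial (hwires (gp0 g)) (behead Gs))
  end.

Definition hadj (G : hgraph) (i j : nat) : bool :=
  has (fun e => ((e.1.1 == Some i) && (e.2.1 == Some j))
             || ((e.1.1 == Some j) && (e.2.1 == Some i))) G.

(** The number of connected components of a graph with vertices [0, ..., n - 1]. *)
Definition ncomponents (n : nat) (G : hgraph) : nat :=
  n_comp (fun i j : 'I_n => hadj G i j) predT
  + count (fun e => (e.1.1 == None) && (e.2.1 == None)) G.

(** ** Degrees and signs *)

Definition td (X : colour) : int :=
  let: (p, q, r) := X in if thin X then q%:Z - 1 else p%:Z - r%:Z + q%:Z.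
Definition dd (X : colour) : int := let: (p, q, r) := X in p%:Z - r%:Z + q%:Z - 1.

Definition gen_sign (g : gen) : int :=
  let p i : int := (nth (gp0 g) (gp0 g :: unzip2 (gl g)) i)%:Z in
  let q i : int := (nth 0 (unzip1 (gl g)) i.-1)%:Z in
  let n := gar g in
  (p 0 + p n) * (gr g)%:Z
  + \sum_(1 <= i < n.+1) (q i - 1) * (n%:Z - i%:Z)
  + \sum_(1 <= i < n.+1) (q i - 1) * ((gp g)%:Z - (gr g)%:Z + p 0 - p i.-1).

Fixpoint gens_sign (t : term) : int :=
  if t is App g ts then gen_sign g + foldr +%R 0 (map gens_sign ts) else 0.

(** Koszul sign of rearranging elements of degrees [dd] from the given order to
    the order of their indices. *)
Fixpoint koszul (s : seq (nat * colour)) : int :=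
  if s is x :: s' then \sum_(y <- s' | (y.1 < x.1)%N) dd x.2 * dd y.2 + koszul s' else 0.

(** Exponent of [(-1)^{S^d}]. *)
Definition d_sign (t : term) : int := gens_sign t + koszul (leaves t).

(** The input colours [X_1, ..., X_n] in the order of the inputs. *)
Definition inputs (t : term) : seq colour :=
  unzip2 (sort (fun x y => (x.1 <= y.1)%N) (leaves t)).

(** [|S^td|] *)
Definition tdeg (t : term) : int := td (out t) - \sum_(X <- inputs t) td X.

(** Exponent of [(-1)^{S^td}]. *)
Definition td_sign (t : term) : int :=
  let Xs := inputs t in
  d_sign t + (size Xs)%:Z
  + \sum_(0 <= i < size Xs) td (nth (0, 0, 0)%N Xs i) * (count non_thin (drop i.+1 Xs))%:Z.

(** Exponent of the sign in the definition of [S^td (theta_1^td, ..., theta_n^td)]. *)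
Definition op_sign (t : term) : int :=
  let Xs := inputs t in
  ((tdeg t * (tdeg t + 1)) %/ 2)%Z + tdeg t * td (out t)
  + \sum_(0 <= i < size Xs) td (nth (0, 0, 0)%N Xs i) * \sum_(X <- drop i.+1 Xs) td X.

Definition thin_quadratic (n : nat) (S : stacking) : Prop :=
  let t := term_of S in
  [/\ standard_order S, nboxes t = n, tdeg t = 2 - n%:Z,
      ncomponents n (horizontal t) = 2 & ~~ has semi_thin (inputs t)].

(** * Operations on a box operad *)

Fixpoint boxes (k : pzRingType) (B : colour -> lmodType k)
    (p0 : nat) (l : seq (nat * nat)) : Type :=
  if l is (q, p) :: l' then (B (p0, q, p) * boxes B p l')%type else unit.

(** The operations of a box operad over [k]; its axioms are not needed to define
    the operations [P_n]. *)
Record box_operations (k : pzRingType) := BoxOperations {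
  bmod :> colour -> lmodType k;
  bcomp : forall g : gen, bmod (ghead g) -> boxes bmod (gp0 g) (gl g) -> bmod (gout g);
  bunit : bmod (0, 1, 0)%N
}.

Section Operations.
Variables (k : comPzRingType) (B : box_operations k).

(** The product of all the [B(p, q, r)], i.e. the product over all degrees of the
    graded module [Tot(s^{-1}_thin B)]. *)
Definition Tot : lmodType k := dprod B.

Definition homogeneous (n : int) (a : Tot) : Prop := forall X, td X <> n -> a X = 0.

Definition inj (X : colour) (b : B X) : Tot := fun Y =>
  match X =P Y with
  | ReflectT e => ecast Z (B Z) e b
  | ReflectF _ => 0
  end.

Fixpoint box_args (p0 : nat) (l : seq (nat * nat)) (vs : seq Tot) : boxes B p0 l :=
  match l return boxes B p0 l with
  | [::] => tt
  | (q, p) :: l' => (head 0 vs (p0, q, p), box_args p l' (behead vs))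
  end.

(** The action of the operad of stackings, extended to the product: the [i]-th
    input, of colour [X], receives the component [a i X]. *)
Fixpoint eval (a : nat -> Tot) (t : term) : Tot :=
  match t with
  | Var i X => inj (a i X)
  | Eta => inj (bunit B)
  | App g ts =>
    let vs := map (eval a) ts in
    inj (bcomp (head 0 vs (ghead g)) (box_args (gp0 g) (gl g) (behead vs)))
  end.

Definition sgn (e : int) : k := (-1) ^+ `|e|%N.

(** [P_n (a_0, ..., a_{n-1})]; its component of colour [Y] collects the stackings
    with output colour [Y]. *)
Definition P (n : nat) (a : nat -> Tot) : Tot := fun Y =>
  \sum_(S \in [set S | thin_quadratic n S /\ out (term_of S) = Y]%classic)
     sgn (td_sign (term_of S)) *: (sgn (op_sign (term_of S)) *: eval a (term_of S) Y).

Definition maurer_cartan (a : Tot) : Prop :=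
  homogeneous 1 a /\
  forall Y, \sum_(n \in [set n | (2 <= n)%N]%classic)
              (-1) ^+ ((n * n.+1)./2) *: P n (fun=> a) Y = 0.

End Operations.

(** * Quivers on a small category *)

Record small_category := SmallCategory {
  ob :> Type;
  arr : ob -> ob -> Type;
  idarr : forall U, arr U U;
  (** [comp u v] is the composite [u v] of [v : W -> V] and [u : V -> U] *)
  comp : forall W V U, arr V U -> arr W V -> arr W U;
  comp1l : forall V U (u : arr V U), comp (idarr U) u = u;
  comp1r : forall V U (u : arr V U), comp u (idarr V) = u;
  compA : forall T W V U (u : arr V U) (v : arr W V) (w : arr T W),
    comp u (comp v w) = comp (comp u v) w
}.
Arguments arr {s} _ _.
Arguments idarr {s} _.
Arguments comp {s W V U} _ _.
Arguments compA {s T W V U} _ _ _.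

Record quiver_on (k : pzRingType) (C : small_category) := QuiverOn {
  qob : C -> Type;
  qhom : forall U, qob U -> qob U -> lmodType k;
  res : forall V U : C, arr V U -> qob U -> qob V
}.
Arguments qob {k C} _ _.
Arguments qhom {k C q U} _ _.
Arguments res {k C q V U} _ _.

(** * The Gerstenhaber-Schack box operad *)

(** [psize s]-simplices [V = U_0 -> ... -> U_p = U]. *)
Notation simplex := (qpath arr).

(** [A_0, ..., A_q] together with [a_i] in [A(U)(A_{i-1}, A_i)]. *)
Notation arrows A U := (qpath (fun X Y : qob A U => qhom X Y)).

(** Strictly increasing maps [f : [r] -> [p]] with [f 0 = 0] and [f r = p], given as
    the list [f 0, ..., f r]. *)
Definition face (r p : nat) (f : seq nat) : bool :=
  [&& size f == r.+1, sorted ltn f, head 0 f == 0 & last 0 f == p].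

Fixpoint subseqs (T : Type) (s : seq T) : seq (seq T) :=
  if s is x :: s' then map (cons x) (subseqs s') ++ subseqs s' else [:: [::]].

Definition faces (r p : nat) : seq (seq nat) := filter (face r p) (subseqs (iota 0 p.+1)).

(** The pairs [(f_1, f_2)] with [f = f_1 o f_2], [f_1 : [r] -> [p]], [f_2 : [t] -> [r]]. *)
Definition factorisations (t r p : nat) (f : seq nat) : seq (seq nat * seq nat) :=
  [seq ff <- [seq (f1, f2) | f1 <- faces r p, f2 <- faces t r] |
     map (nth 0%N ff.1) ff.2 == f].

Section Box.
Variables (k : comPzRingType) (C : small_category) (A : quiver_on k C).

(** [sigma^*] *)
Fixpoint pull (V U : C) (s : simplex V U) : qob A U -> qob A V :=
  match s in qpath _ V U return qob A U -> qob A V with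
  | pnil _ => id
  | pcons _ _ _ u s' => fun X => res u (pull s' X)
  end.

Definition extend (V W U : C) (u : arr V W) (s : simplex W U) : simplex V U :=
  match s in qpath _ W U return arr V W -> simplex V U with
  | pnil _ => fun u => pcons u (pnil _)
  | pcons _ _ _ v s' => fun u => pcons (comp v u) s'
  end u.

(** Keeps the two end vertices and the inner vertices whose position lies in [f],
    the vertices being numbered from [i] on, and composes the arrows in between. *)
Fixpoint restr_from (f : seq nat) (i : nat) (V U : C) (s : simplex V U) : simplex V U :=
  match s in qpath _ V U return simplex V U with
  | pnil _ => pnil _
  | pcons _ _ _ u s' =>
    if i.+1 \in f then pcons u (restr_from f i.+1 s') else extend u (restr_from f i.+1 s')
  end.

(** [f(sigma)] *)
Definition restr (f : seq nat) (V U : C) (s : simplex V U) : simplex V U :=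
  restr_from f 0 s.

Record cell := Cell {
  cV : C; cU : C; csimplex : simplex cV cU; cface : seq nat;
  cdom : qob A cU; ccod : qob A cU; carrows : arrows A cU cdom ccod
}.

Definition cochain : lmodType k := dprod (fun d : cell =>
  qhom (pull (csimplex d) (cdom d)) (pull (restr (cface d) (csimplex d)) (ccod d))).

Definition multilinear (theta : cochain) : Prop :=
  forall V U (s : simplex V U) f X0 X Y Xq
    (x : arrows A U X0 X) (y : arrows A U Y Xq) (c : k) (a b : qhom X Y),
  let th a := theta (Cell s f (pcat x (pcons a y))) in
  th (c *: a + b) = c *: th a + th b.

Definition shape (X : colour) (d : cell) : bool :=
  let: (p, q, r) := X in
  [&& psize (csimplex d) == p, face r p (cface d) & psize (carrows d) == q].

(** Elements of [C_box^{p,q,r}], extended by zero to the cells of other shapes. *)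
Definition is_cbox (X : colour) : {pred cochain} := fun theta =>
  `[< multilinear theta /\ forall d, ~~ shape X d -> theta d = 0 >].

Fact is_cbox_submod_closed X : submod_closed (is_cbox X).
Proof.
split.
  apply/asboolP; split=> [|//] V U s f X0 Y Z Xq x y c a b /=.
  by apply: esym; etransitivity; [exact: addr0 | exact: scaler0].
move=> c t t' /asboolP[mt st] /asboolP[mt' st']; apply/asboolP; have E d : (c *: t + t') d = c *: t d + t' d by [].
split.
  move=> V U s f X0 Y Z Xq x y c' a b /=; rewrite !E mt mt' !scalerDr !scalerA [c * c']mulrC -!addrA; congr (_ + _).
  by rewrite addrCA.
by move=> d nd; rewrite E (st d nd) (st' d nd) scaler0 addr0.
Qed.
HB.instance Definition _ X := GRing.isSubmodClosed.Build k cochain (is_cbox X)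
  (is_cbox_submod_closed X).
Record cbox (X : colour) := CBox { cbox_val :> cochain; cbox_valP : cbox_val \in is_cbox X }.
HB.instance Definition _ X := [isSub for @cbox_val X].
HB.instance Definition _ X := [Choice of cbox X by <:].
HB.instance Definition _ X := [SubChoice_isSubLmodule of cbox X by <:].

(** The identification of modules of morphisms along equalities of their ends (the
    ends agree wherever this is used below). *)
Definition hom_cast (U : C) (X Y X' Y' : qob A U) (h : qhom X Y) : qhom X' Y' :=
  match pselect (X = X'), pselect (Y = Y') with
  | left e, left e' => ecast Z (qhom Z Y') e (ecast Z (qhom X Z) e' h)
  | _, _ => 0
  end.

(** The component at [s], [f] and [x] of [theta_1 (x)_A ... (x)_A theta_n], as a list
    of pure tensors [y_1 (x) ... (x) y_n] (with their common target), one for each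
    factorisation [f = f_1 o ... o f_n]. *)
Fixpoint tens (p0 : nat) (l : seq (nat * nat)) : boxes cbox p0 l ->
    forall (V U : C) (s : simplex V U) (f : seq nat) X Y, arrows A U X Y ->
    seq {Z : qob A V & arrows A V (pull s X) Z} :=
  match l return boxes cbox p0 l -> _ with
  | [::] => fun _ V U s f X Y x => [:: existT _ (pull s X) (pnil (pull s X))]
  | (q, p) :: l' => fun ths V U s f X Y x =>
    let: existT M (x1, x2) := psplit q x in
    [seq existT _ (projT1 y) (pcons (cbox_val ths.1 (Cell s f12.1 x1)) (projT2 y)) |
      f12 <- factorisations (last p (unzip2 l')) p p0 f,
      y <- tens ths.2 (restr f12.1 s) f12.2 x2]
  end.

Fact hom_cast_linear U (X Y X' Y' : qob A U) (c : k) (a b : qhom X Y) :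
  hom_cast X' Y' (c *: a + b) = c *: hom_cast X' Y' a + hom_cast X' Y' b.
Proof.
rewrite /hom_cast; case: pselect => [e|_]; last by rewrite scaler0 addr0.
case: pselect => [e'|_]; last by rewrite scaler0 addr0.
by case: _ / e; case: _ / e'.
Qed.

Fact psplit_left U (X0 X Y Xq : qob A U) (x : arrows A U X0 X) (y : arrows A U Y Xq) n :
  (n <= psize x)%N -> exists M (x1 : arrows A U X0 M) (x2 : arrows A U M X),
    (psize x1 = n /\ psize x1 + psize x2 = psize x)%N /\
    forall a : qhom X Y, psplit n (pcat x (pcons a y)) = existT _ M (x1, pcat x2 (pcons a y)).
Proof.
elim: x n => [Z|Z1 Z2 Z3 u x IH] [|n] //=.
- by move=> _; exists Z, (pnil _), (pnil _).
- by move=> _; exists Z1, (pnil _), (pcons u x).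
move=> /IH /= {IH}IH; case: IH => [M [x1 [x2 [[e1 e2] E]]]].
exists M, (pcons u x1), x2; split=> [|a]; last by rewrite E.
by rewrite /= addSn e1 -e2 e1.
Qed.

Fact psplit_right U (X0 X Y Xq : qob A U) (x : arrows A U X0 X) (y : arrows A U Y Xq) n :
  (psize x < n)%N -> exists M (y1 : arrows A U Y M) (y2 : arrows A U M Xq),
    forall a : qhom X Y, psplit n (pcat x (pcons a y)) = existT _ M (pcat x (pcons a y1), y2).
Proof.
elim: x n => [Z|Z1 Z2 Z3 u x IH] [|n] //=.
- move=> _; case E : (psplit n y) => [M [y1 y2]]; exists M, y1, y2 => a //=.
move=> /IH /= {IH}IH; case: IH => [M [y1 [y2 E]]].
by exists M, y1, y2 => a; rewrite E.
Qed.

Fact tens_linear (W : lmodType k) p0 l (ths : boxes cbox p0 l) V U (s : simplex V U) f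
    X0 X Y Xq (x : arrows A U X0 X) (y : arrows A U Y Xq)
    (F : forall Z, arrows A V (pull s X0) Z -> W) (c : k) (a b : qhom X Y) :
  (psize x + (psize y).+1 = sumn (unzip1 l))%N ->
  (forall X Y Z (u : arrows A V (pull s X0) X) (v : arrows A V Y Z) (c : k) (a b : qhom X Y),
     F Z (pcat u (pcons (c *: a + b) v))
     = c *: F Z (pcat u (pcons a v)) + F Z (pcat u (pcons b v))) ->
  let G a := \sum_(z <- tens ths s f (pcat x (pcons a y))) F _ (projT2 z) in
  G (c *: a + b) = c *: G a + G b.
Proof.
elim: l p0 ths s f X0 x F => [|[q p] l IH] p0 ths s f X0 x F /=.
  by rewrite addnS.
case: ths => th ths /= szxy linF.
have {}lin_th := asboolP _ (cbox_valP th).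
have [le_q|lt_q] := leqP q (psize x).
  have [M [x1 [x2 [[sz1 sz2] E]]]] := psplit_left y le_q.
  rewrite !E !big_allpairs_dep /= scaler_sumr -big_split /=.
  apply: eq_bigr => f12 _.
  pose F' Z (u : arrows A V (pull (restr f12.1 s) M) Z) :=
    F Z (pcons (cbox_val th (Cell s f12.1 x1)) u).
  apply: (IH _ ths _ _ _ _ F').
    apply/eqP; rewrite -(eqn_add2l q) -szxy -sz2 sz1 addnA eqxx.
    by [].
  move=> X1 Y1 Z u v c' a' b'; exact: (linF _ _ _ (pcons _ u)).
have [M [y1 [y2 E]]] := psplit_right y lt_q.
rewrite !E !big_allpairs_dep /= scaler_sumr -big_split /=.
apply: eq_bigr => f12 _; rewrite scaler_sumr -big_split /=.
apply: eq_bigr => z _.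
have [ml _] := lin_th.
rewrite ml; exact: (linF _ _ _ (pnil _)).
Qed.

Definition comp_cochain (g : gen) (th : cbox (ghead g)) (ths : boxes cbox (gp0 g) (gl g)) :
    cochain := fun d =>
  let: Cell V U s f X Y x := d in
  if shape (gout g) (Cell s f x) && (nth 0%N f (gr g) == gp g) then
    let: existT _ (s1, s2) := psplit (gp g) s in
    let f1 := take (gr g).+1 f in
    let f2 := [seq (j - gp g)%N | j <- drop (gr g) f] in
    \sum_(y <- tens ths s2 f2 x)
      (hom_cast (pull s X) (pull (restr f s) Y) (cbox_val th (Cell s1 f1 (projT2 y)))
       : qhom _ _)
  else 0.

Fact comp_cochain_cbox g th ths : @comp_cochain g th ths \in is_cbox (gout g).
Proof.
apply/asboolP; split=> [|[V U s f X Y x] nd]; last by rewrite /comp_cochain (negPf nd).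
move=> V U s f X0 X Y Xq x y c a b; rewrite /comp_cochain /=.
rewrite !psize_cat /=; case: ifP => [/andP[/and3P[_ _ /eqP szxy] _]|_]; last first.
  by apply: esym; etransitivity; [exact: addr0 | exact: scaler0].
case: (psplit (gp g) s) => V' [s1 s2].
pose F (Z : qob A V') (u : arrows A V' (pull s2 X0) Z) := hom_cast (pull s X0) (pull (restr f s) Xq)
  (cbox_val th (Cell s1 (take (gr g).+1 f) u)) : qhom _ _.
apply: (tens_linear ths (s := s2) _ c a b (F := F)) => // X1 Y1 Z u v c' a' b'; rewrite /F.
have [ml _] := asboolP _ (cbox_valP th).
by rewrite ml hom_cast_linear.
Qed.

Definition cbox_comp (g : gen) (th : cbox (ghead g)) (ths : boxes cbox (gp0 g) (gl g)) :
    cbox (gout g) :=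
  CBox (comp_cochain_cbox th ths).

(** The arrow of a path of length [1]. *)
Definition single U (X Y : qob A U) (x : arrows A U X Y) : qhom X Y :=
  match x in qpath _ X Y return qhom X Y with
  | pnil _ => 0
  | pcons X _ Z a x' =>
    match x' in qpath _ Y Z return qhom X Y -> qhom X Z with
    | pnil _ => id
    | pcons _ _ _ _ _ => fun=> 0
    end a
  end.

Definition unit_cochain : cochain := fun d =>
  let: Cell V U s f X Y x := d in
  match s in qpath _ V U return forall X Y : qob A U, arrows A U X Y ->
      qhom (pull s X) (pull (restr f s) Y) with
  | pnil _ => fun X Y x => if f == [:: 0%N] then single x else 0
  | pcons _ _ _ _ _ => fun _ _ _ => 0
  end X Y x.

Fact unit_cochain_cbox : unit_cochain \in is_cbox (0, 1, 0)%N.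
Proof.
have E0 (M : lmodType k) c : (0 : M) = c *: 0 + 0 by rewrite scaler0 addr0.
apply/asboolP; split=> [V U s f X0 X Y Xq x y c a b|[V U s f X Y x]] /=.
  case: s X0 X Y Xq x y a b => [U'|? ? ? ? ?] X0 X Y Xq x y a b; last exact: E0.
  case: eqP => _; last exact: E0.
  case: x a b => [Z|Z1 Z2 Z3 u x] a b /=.
    by case: y a b => [?|? ? ? ? ?] a b //; exact: E0.
  by case: x u a b => [?|? ? ? ? ?] u a b; exact: E0.
case: s X Y x => [U'|? ? ? ? ?] X Y x //=.
have [-> /=|//] := eqVneq f [:: 0%N].
by case: x => [?|? ? ? a x] //; case: x a.
Qed.

Definition cbox_unit : cbox (0, 1, 0)%N := CBox unit_cochain_cbox.

Definition GS_box : box_operations k := @BoxOperations k (fun X => cbox X) cbox_comp cbox_unit.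

(** * The Gerstenhaber-Schack object *)

Definition CGS (p q : nat) : lmodType k := cbox (p, q, if p is 0 then 0 else 1)%N.

(** The degree [1] part of [s^{-1} C_GS(A)], and its inclusion in the degree [1] part
    of [Tot]. *)
Definition CGS2 : Type := (CGS 0 2 * CGS 1 1 * CGS 2 0)%type.

Definition GS_incl (a : CGS2) : Tot GS_box :=
  let: (m, f, c) := a in
  inj (B := GS_box) (X := (0, 2, 0)%N) m
  + inj (B := GS_box) (X := (1, 1, 1)%N) f
  + inj (B := GS_box) (X := (2, 0, 1)%N) c.

(** The data [(m, f, c)] underlying an element of [C_GS^2(A)]. *)
Definition GS_m (m : CGS 0 2) (U : C) (A0 A1 A2 : qob A U) (a : qhom A0 A1) (b : qhom A1 A2) :
    qhom A0 A2 :=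
  cbox_val m (Cell (pnil U) [:: 0%N] (pcons a (pcons b (pnil A2)))).

Definition GS_f (f : CGS 1 1) (V U : C) (u : arr V U) (A0 A1 : qob A U) (a : qhom A0 A1) :
    qhom (res u A0) (res u A1) :=
  cbox_val f (Cell (pcons u (pnil U)) [:: 0; 1]%N (pcons a (pnil A1))).

Definition GS_c (c : CGS 2 0) (W V U : C) (u : arr V U) (v : arr W V) (X : qob A U) :
    qhom (res v (res u X)) (res (comp u v) X) :=
  cbox_val c (Cell (pcons v (pcons u (pnil U))) [:: 0; 2]%N (pnil X)).

(** * Lax prestacks *)

(** As in the Maurer-Cartan equation, no identity morphisms are part of the data:
    categories and functors are non-unital.  Composition is written in diagrammatic
    order, [m a b] being [a] followed by [b]. *)
Definition composition (U : C) : Type :=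
  forall A0 A1 A2 : qob A U, qhom A0 A1 -> qhom A1 A2 -> qhom A0 A2.

Definition is_linear_category (U : C) (m : composition U) : Prop :=
  [/\ forall A0 A1 A2 (t : k) (a a' : qhom A0 A1) (b : qhom A1 A2),
        m _ _ _ (t *: a + a') b = t *: m _ _ _ a b + m _ _ _ a' b,
      forall A0 A1 A2 (t : k) (a : qhom A0 A1) (b b' : qhom A1 A2),
        m _ _ _ a (t *: b + b') = t *: m _ _ _ a b + m _ _ _ a b'
    & forall A0 A1 A2 A3 (a : qhom A0 A1) (b : qhom A1 A2) (d : qhom A2 A3),
        m _ _ _ (m _ _ _ a b) d = m _ _ _ a (m _ _ _ b d)].

Section Functors.
Variables (U V : C) (mU : composition U) (mV : composition V).

Definition functor_on (F : qob A U -> qob A V) : Type :=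
  forall A0 A1, qhom A0 A1 -> qhom (F A0) (F A1).

Definition is_linear_functor F (Fm : functor_on F) : Prop :=
  (forall A0 A1 (t : k) (a a' : qhom A0 A1), Fm _ _ (t *: a + a') = t *: Fm _ _ a + Fm _ _ a')
  /\ (forall A0 A1 A2 (a : qhom A0 A1) (b : qhom A1 A2),
        Fm _ _ (mU a b) = mV (Fm _ _ a) (Fm _ _ b)).

Definition is_natural F (Fm : functor_on F) G (Gm : functor_on G)
    (n : forall X, qhom (F X) (G X)) : Prop :=
  forall A0 A1 (a : qhom A0 A1), mV (Fm _ _ a) (n A1) = mV (n A0) (Gm _ _ a).

End Functors.

Record is_lax_prestack (m : forall U : C, composition U)
    (f : forall (V U : C) (u : arr V U), functor_on (fun X : qob A U => res u X))
    (c : forall (W V U : C) (u : arr V U) (v : arr W V) (X : qob A U),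
       qhom (res v (res u X)) (res (comp u v) X)) : Prop := IsLaxPrestack {
  lax_category : forall U : C, is_linear_category (m U);
  lax_restriction : forall (V U : C) (u : arr V U),
    is_linear_functor (m U) (m V) (f V U u);
  lax_twist : forall (W V U : C) (u : arr V U) (v : arr W V),
    is_natural (m W) (fun A0 A1 a => f W V v _ _ (f V U u A0 A1 a)) (f W U (comp u v))
      (c W V U u v);
  lax_coherence : forall (T W V U : C) (u : arr V U) (v : arr W V) (w : arr T W) (X : qob A U),
    m T _ _ _ (f T W w _ _ (c W V U u v X)) (c T W U (comp u v) w X)
    = ecast g (qhom (res w (res v (res u X))) (res g X)) (compA u v w)
        (m T _ _ _ (c T W V v w (res u X)) (c T V U u (comp v w) X))
}.

End Box.

(* Main.v *)
Require Import Defs.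
From HB Require Import structures.
From mathcomp Require Import all_boot all_algebra.
From mathcomp Require Import boolp classical_sets fsbigop.
From mathcomp Require Import zify.

Set Implicit Arguments.
Unset Strict Implicit.
Unset Printing Implicit Defensive.

Import GRing.Theory Defs.

(** The element [(m, f, c)] lives in the colours [(0, 2, 0)], [(1, 1, 1)] and
    [(2, 0, 1)] only, so in [P_n(alpha, ..., alpha)] only the stackings whose boxes
    have these colours survive: [eval_zero].  A stacking in standard order with such
    boxes is a tree of products, restrictions and twists; the only ambiguity is that
    an operadic identity may or may not be filled up with copies of [eta]
    ([std_normalizes]).

    The two other conditions on a thin-quadratic stacking are numerical.  The degree
    condition says that the output has degree [2].  For the graph, the number of
    components of any graph is at least the number of vertices minus the number of
    internal edges plus the number of wires; for a horizontal composite with [R]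
    outputs this bound is [n - sum r_i + R] ([euler_bound]), which is the number of
    products in the tree plus [R].  Hence that number is at most [2], and a case
    analysis on trees leaves exactly eight of them ([quadratic_classification]),
    two for each of four output colours:

    - [(0, 3, 0)]: [m (m a b) d] and [m a (m b d)];
    - [(1, 2, 1)]: [f (m a b)] and [m (f a) (f b)];
    - [(2, 1, 1)]: [m (f (f a)) c] and [m c (f a)];
    - [(3, 0, 1)]: [m (f c) c] and [m c c].

    In each pair the two total signs are opposite ([quadratic_parities]), so the
    Maurer-Cartan equation in the four colours states that the two members of each
    pair agree.  Evaluated on cells these are the associativity of composition, the
    functoriality of restrictions, the naturality of twists and their coherence.

    Since a sum over stackings is a sum over classes of terms, the eight trees must
    also represent distinct classes.  Besides the multiset of boxes, the relations
    preserve the sequence of depths at which the vertical inputs of a stacking sit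
    ([teq_depths]); together these tell the eight trees apart. *)

(** * Connected components of horizontal composite graphs *)

Definition internal (e : port * port) : bool := isSome e.1.1 && isSome e.2.1.
Definition wire (e : port * port) : bool := (e.1.1 == None) && (e.2.1 == None).

Lemma hadj_connect_sym n G : connect_sym (fun i j : 'I_n => hadj G i j).
Proof.
apply: sym_connect_sym => i j; rewrite /hadj; apply: eq_has => e.
by rewrite orbC.
Qed.

(** Colour the vertices with two colours.  A colouring is determined by the colours
    of one root per component and by the set of edges along which the colour jumps,
    whence [2 ^ n <= 2 ^ c * 2 ^ e]. *)
Lemma leq_ncomp_internal n G :
  n <= n_comp (fun i j : 'I_n => hadj G i j) predT + count internal G.
Proof.
set adj := fun i j : 'I_n => hadj G i j.
pose val_at (f : {ffun 'I_n -> bool}) (o : option nat) :=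
  if obind insub o is Some i then f i else false.
pose jump f := [tuple of
  map (fun e => val_at f e.1.1 (+) val_at f e.2.1) (in_tuple (filter internal G))].
pose phi (f : {ffun 'I_n -> bool}) := ([ffun r : {i | fingraph.roots adj i} => f (val r)], jump f).
suff /leq_card : injective phi.
  rewrite card_prod card_tuple !card_ffun card_bool card_ord card_sig.
  rewrite -expnD leq_exp2l // size_filter.
  by rewrite (eq_card (B := predI (fingraph.roots adj) predT)) // => i; rewrite !inE andbT.
move=> f g [/ffunP eq_roots eq_jump].
(* [f] and [g] jump along the same edges, so their difference never jumps. *)
have step i j : adj i j -> f i (+) g i = f j (+) g j.
  case/hasP => e eG ij.
  have eE : e \in filter internal G.
    by rewrite mem_filter eG andbT /internal; case/orP: ij => /andP[/eqP-> /eqP->].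
  move/eq_in_map: eq_jump => /(_ e eE).
  have val_ord h (l : 'I_n) : val_at h (Some (l : nat)) = h l by rewrite /val_at /= valK.
  case/orP: ij => /andP[/eqP-> /eqP->]; rewrite !val_ord;
    by case: (f i) (f j) (g i) (g j) => [] [] [] [].
have const i j : connect adj i j -> f i (+) g i = f j (+) g j.
  case/connectP => p; elim: p i => [|l p IH] i /=; first by move=> _ ->.
  by case/andP => /step -> /IH.
apply/ffunP => i.
have := const _ _ (connect_root adj i).
have r : fingraph.roots adj (fingraph.root adj i) by rewrite roots_root //; exact: hadj_connect_sym.
have := eq_roots (exist (fun i => fingraph.roots adj i) _ r); rewrite !ffunE /= => ->.
by rewrite addbb; case: (f i) (g i) => [] [].
Qed.

Lemma n_comp_le2 n G (i j : 'I_n) :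
  (forall l, l = i \/ l = j \/ hadj G l j) ->
  n_comp (fun i j : 'I_n => hadj G i j) predT <= 2.
Proof.
move=> cover; set adj := fun i j : 'I_n => hadj G i j.
have sym : connect_sym adj := @hadj_connect_sym n G.
rewrite -[2](size_tuple [tuple fingraph.root adj i; fingraph.root adj j]).
apply: leq_trans (card_size _); apply: subset_leq_card; apply/fintype.subsetP => l.
rewrite !inE andbT => /eqP <-.
case: (cover l) => [->|[->|lj]]; rewrite ?eqxx ?orbT //.
by rewrite [X in _ || X](_ : _ = true) ?orbT //; apply/eqP/(fingraph.rootP sym); exact: connect1.
Qed.

(** Each of the [P] inputs and each of the [R] outputs is the end of exactly one edge.
    This is what makes a serial composite count as a bijective matching of ports. *)
Definition ported (P R : nat) (G : hgraph) : Prop :=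
  (forall j, count (fun e => e.1 == (None, j)) G = (j < P)) /\
  (forall j, count (fun e => e.2 == (None, j)) G = (j < R)).

Lemma count_None (f : port * port -> port) N (G : hgraph) :
  (forall j, count (fun e => f e == (None, j)) G = (j < N)) ->
  count (fun e => (f e).1 == None) G = N.
Proof.
move=> cnt; rewrite -size_filter -(size_map (fun e => (f e).2)) -[RHS](size_iota 0).
apply: perm_size; apply/allP => j _ /=.
rewrite [X in _ == X]count_uniq_mem ?iota_uniq // mem_iota /= add0n -cnt count_map count_filter.
apply/eqP/eq_count => e /=; rewrite andbC.
by case: (f e) => x y /=; rewrite xpair_eqE.
Qed.

Lemma ported_sources P R G : ported P R G -> count (fun e => e.1.1 == None) G = P.
Proof. by case=> + _; apply: count_None. Qed.
Lemma ported_targets P R G : ported P R G -> count (fun e => e.2.1 == None) G = R.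
Proof. by case=> _; apply: count_None. Qed.

Lemma ported_internal P R G : ported P R G ->
  count internal G + P + R = size G + count wire G.
Proof.
move=> po; have := ported_sources po; have := ported_targets po.
have := count_predUI (fun e : port * port => e.1.1 == None) (fun e => e.2.1 == None) G.
rewrite -[size G](count_predC internal G) (eq_count (a1 := predU _ _) (a2 := predC internal)).
  by rewrite (eq_count (a1 := predI _ _) (a2 := wire)) // => UI <- <-; rewrite -[RHS]addnA UI addnA.
by move=> e; rewrite /= /internal; case: e => -[[x|] ?] [[y|] ?].
Qed.

Lemma ported_vertex i p q r :
  ported p r (hvertex i (p, q, r)) /\ size (hvertex i (p, q, r)) = p + r.
Proof.
rewrite /hvertex; split; last by rewrite size_cat !size_map !size_iota.
have F0 (T : Type) (s : seq T) : count (fun=> false) s = 0 by apply: count_pred0.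
split=> j; rewrite count_cat !count_map /preim /=.
  rewrite F0 addn0 (eq_count (a2 := pred1 j)); last by move=> l; rewrite /= xpair_eqE.
  by rewrite count_uniq_mem ?iota_uniq // mem_iota.
rewrite F0 add0n (eq_count (a2 := pred1 j)); last by move=> l; rewrite /= xpair_eqE.
by rewrite count_uniq_mem ?iota_uniq // mem_iota.
Qed.

Lemma ported_wires p : ported p p (hwires p).
Proof.
split=> j; rewrite count_map (eq_count (a2 := pred1 j)) 1?count_uniq_mem ?iota_uniq ?mem_iota //.
all: by move=> l; rewrite /= xpair_eqE.
Qed.

Lemma ported_juxtapose p r p' r' G G' : ported p r G -> ported p' r' G' ->
  ported (p + p') (r + r') (hjuxtapose p r G G').
Proof.
move=> [Gi Go] [G'i G'o].
have shift (f : port * port -> port) N N' :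
  (forall j, count (fun e => f e == (None, j)) G' = (j < N')) ->
  forall j, count (fun e => port_shift N (f e) == (None, j)) G' = ((j < N + N') - (j < N) :> nat).
  move=> cnt j; have [ltjN|leNj] := ltnP j N.
    rewrite (leq_trans ltjN (leq_addr _ _)) subnn; apply/eqP; rewrite -leqn0 leqNgt -has_count.
    apply/hasPn => e _; case: (f e) => -[x|] l; rewrite /port_shift //= xpair_eqE /=; lia.
  rewrite subn0 -[in RHS](subnKC leNj) ltn_add2l -cnt; apply: eq_count => e.
  by case: (f e) => -[x|] l; rewrite /port_shift //= !xpair_eqE /=; lia.
split=> j; rewrite count_cat count_map /preim /=.
  by rewrite Gi (shift fst p p' G'i); lia.
by rewrite Go (shift snd r r' G'o); lia.
Qed.

Lemma count_allpairs (T : Type) (G G' : seq T) (a : pred (T * T)) :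
  count a [seq (e, e') | e <- G, e' <- G'] = \sum_(e <- G) \sum_(e' <- G') a (e, e').
Proof.
elim: G => [|e G IH] /=; first by rewrite big_nil.
by rewrite count_cat IH big_cons count_map; congr (_ + _); rewrite -sum1_count big_mkcond.
Qed.

(** The pairs of edges that [hserial] fuses into one edge. *)
Definition joined (G G' : hgraph) : seq ((port * port) * (port * port)) :=
  [seq ee <- [seq (e, e') | e <- G, e' <- G'] | (ee.1.2.1 == None) && (ee.1.2 == ee.2.1)].

Section Joined.
Variables (P Q R : nat) (G G' : hgraph).
Hypotheses (GP : ported P Q G) (G'P : ported Q R G').

(** Every edge of [G] ending at an output is fused with exactly one edge of [G'], so
    fused pairs can be counted on either side. *)
Lemma count_joined_l a :
  count (fun ee => a ee.1) (joined G G') = count (fun e => a e && (e.2.1 == None)) G.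
Proof.
rewrite count_filter count_allpairs -sum1_count [RHS]big_mkcond /=.
rewrite big_seq_cond [RHS]big_seq_cond; apply: eq_bigr => e; rewrite andbT => eG.
case: ifP => [/andP[ae /eqP e2]|nae]; last by rewrite big1 // => e' _; rewrite andbA nae.
have [j Ej] : exists j, e.2 = (None, j) by move: e2; case: (e.2) => x j /= ->; exists j.
have jQ : j < Q.
  move: (GP.2 j); case: (j < Q) => //= /eqP; rewrite -leqn0 leqNgt -has_count => /hasPn/(_ e eG).
  by rewrite Ej eqxx.
transitivity (nat_of_bool (j < Q)); last by rewrite jQ.
rewrite -(G'P.1 j) -sum1_count [RHS]big_mkcond /=; apply: eq_bigr => e' _.
by rewrite ae e2 eqxx Ej /= eq_sym; case: eqP.
Qed.

Lemma count_joined_r a :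
  count (fun ee => a ee.2) (joined G G') = count (fun e => a e && (e.1.1 == None)) G'.
Proof.
rewrite count_filter count_allpairs exchange_big -sum1_count [RHS]big_mkcond /=.
rewrite big_seq_cond [RHS]big_seq_cond; apply: eq_bigr => e; rewrite andbT => eG.
case: ifP => [/andP[ae /eqP e2]|nae]; last first.
  rewrite big1 // => e' _; case: andP => // -[/= ae /andP[/eqP e'2 /eqP e'e]].
  by move: nae; rewrite ae -e'e e'2.
have [j Ej] : exists j, e.1 = (None, j) by move: e2; case: (e.1) => x j /= ->; exists j.
have jQ : j < Q.
  move: (G'P.1 j); case: (j < Q) => //= /eqP; rewrite -leqn0 leqNgt -has_count => /hasPn/(_ e eG).
  by rewrite Ej eqxx.
transitivity (nat_of_bool (j < Q)); last by rewrite jQ.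
rewrite -(GP.2 j) -sum1_count [RHS]big_mkcond /=; apply: eq_bigr => e' _.
by rewrite ae Ej /= andbC; case: eqP => [->|].
Qed.

Lemma ported_serial : ported P R (hserial G G').
Proof.
have split_count (a b : pred (port * port)) s :
  count (predI a (predC b)) s + count (fun e => a e && b e) s = count a s.
  rewrite -[RHS]size_filter -(count_predC b [seq e <- s | a e]) !count_filter addnC.
  by congr (_ + _); apply: eq_count => e; rewrite /= andbC.
split=> j; rewrite /hserial !count_cat !count_filter count_map.
- rewrite -(GP.1 j) -[RHS](split_count _ (fun e => e.2.1 == None)) -[X in _ = _ + X]add0n.
  congr (_ + (_ + _)).
  + by apply: eq_count => e; rewrite /=; case: (e.2.1).
  + apply/eqP; rewrite -leqn0 leqNgt -has_count.
    by apply/hasPn => -[[[x|] l] y] _; rewrite //= andbF.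
  + exact: (count_joined_l (fun e => e.1 == (None, j))).
- rewrite -(G'P.2 j) -[RHS](split_count _ (fun e => e.1.1 == None)) -[RHS]add0n.
  congr (_ + (_ + _)).
  + apply/eqP; rewrite -leqn0 leqNgt -has_count.
    by apply/hasPn => -[x [[y|] l]] _; rewrite //= andbF.
  + by apply: eq_count => e; rewrite /=; case: (e.1.1).
  + exact: (count_joined_r (fun e => e.2 == (None, j))).
Qed.

Lemma size_serial : size (hserial G G') + Q = size G + size G'.
Proof.
rewrite /hserial !size_cat size_map -/(joined G G') -(count_predT (joined G G')).
rewrite (count_joined_r xpredT) (ported_sources G'P) !size_filter.
rewrite -(count_predC (fun e => e.2.1 == None) G) (ported_targets GP).
rewrite -(count_predC (fun e => e.1.1 == None) G') (ported_sources G'P).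
rewrite (eq_count (a2 := predC (fun e => e.2.1 == None))); last by move=> e /=; case: (e.2.1).
rewrite [X in _ + (X + _)](eq_count (a2 := predC (fun e => e.1.1 == None))); first lia.
by move=> e /=; case: (e.1.1).
Qed.
End Joined.

Lemma term_ind_in (Pr : term -> Prop) :
  (forall i X, Pr (Var i X)) -> Pr Eta ->
  (forall g ts, {in ts, forall t, Pr t} -> Pr (App g ts)) ->
  forall t, Pr t.
Proof.
move=> PV PE PA; fix IH 1 => -[i X||g ts]; [exact: PV|exact: PE|apply: PA].
elim: ts => [|t ts IHts] s; first by rewrite in_nil => absurd; discriminate absurd.
by rewrite inE => /predU1P[->|]; [exact: IH | exact: IHts].
Qed.

Definition outgoing (s : seq (nat * colour)) : nat := sumn [seq x.2.2 | x <- s].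

Lemma outgoing_cat s s' : outgoing (s ++ s') = outgoing s + outgoing s'.
Proof. by rewrite /outgoing map_cat sumn_cat. Qed.

Lemma typed_app g ts : typed (App g ts) ->
  exists t ts', [/\ ts = t :: ts', out t = ghead g, map out ts' = chain_colours (gp0 g) (gl g),
    typed t & all typed ts'].
Proof.
case: ts => [|t ts']; first by case/andP => /eqP.
by case/andP => /eqP[ot ots] /andP[tt tts]; exists t, ts'.
Qed.

Lemma ported_chain ts P R p0 l G :
  {in ts, forall t, let: (p, q, r) := out t in ported p r (horizontal t) /\
                    size (horizontal t) = p + outgoing (leaves t)} ->
  ported P p0 G -> size G = P + R -> map out ts = chain_colours p0 l ->
  let H := foldl hserial G (map horizontal ts) in
  ported P (last p0 (unzip2 l)) H /\ size H = P + (R + outgoing (flatten (map leaves ts))).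
Proof.
elim: ts P R p0 l G => [|t ts IH] P R p0 [|[q p] l] G //=; first by rewrite addn0.
move=> Pt poG szG [ot ots].
have := Pt t (mem_head _ _); rewrite ot => -[pot szt].
have [|||po sz] := IH P (R + outgoing (leaves t)) p l (hserial G (horizontal t)) _ _ _ ots.
- by move=> s sts; apply: Pt; rewrite inE sts orbT.
- exact: ported_serial poG pot.
- by have := size_serial poG pot; rewrite szt szG; lia.
by split=> //; rewrite sz outgoing_cat !addnA.
Qed.

Lemma ported_horizontal t : typed t ->
  let: (p, q, r) := out t in
  ported p r (horizontal t) /\ size (horizontal t) = p + outgoing (leaves t).
Proof.
elim/term_ind_in: t => [i [[p q] r] _|_|g ts IH tyt].
- by have [po sz] := ported_vertex i p q r; rewrite /outgoing /= addn0.
- by [].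
have [t [ts' [Ets ot ots tyt' tyts]]] := typed_app tyt.
have := IH t; rewrite {1}Ets mem_head ot => /(_ isT tyt')[po sz].
have IHts : {in ts', forall t, let: (p, q, r) := out t in ported p r (horizontal t) /\
                    size (horizontal t) = p + outgoing (leaves t)}.
  by move=> s sts; apply: IH; rewrite ?Ets ?inE ?sts ?orbT //; exact: (allP tyts).
have [|po' sz'] := ported_chain IHts (ported_wires (gp0 g)) (R := 0) _ ots.
  by rewrite size_map size_iota addn0.
rewrite Ets /=; split; first exact: ported_juxtapose.
rewrite /hjuxtapose size_cat size_map sz sz' outgoing_cat; lia.
Qed.

(** Counting edges by their sources gives [P + sum r_i] of them.  Removing those that
    start at an input or end at an output, and putting back the wires, which were
    removed twice, leaves [sum r_i - R + wires] internal edges. *)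
Lemma euler_bound t : typed t ->
  nboxes t + (out t).2 <= ncomponents (nboxes t) (horizontal t) + outgoing (leaves t).
Proof.
move=> /ported_horizontal; case: (out t) => [[p q] r] [po sz] /=.
have := ported_internal po; have := leq_ncomp_internal (nboxes t) (horizontal t).
set c := n_comp _ _; rewrite -[ncomponents _ _]/(c + count wire (horizontal t)) sz; lia.
Qed.

(** * Trees of products, restrictions and twists *)

(** [One] stands for [eta], and [Mult], [Fun], [Twist] for a generator whose first
    input is a box of colour [(0, 2, 0)], [(1, 1, 1)], [(2, 0, 1)].  The argument of
    [Twist] is the number [p_0] of wires of the generator, which is part of the data
    when there are no further inputs. *)
Inductive tree := One | Mult of tree & tree | Fun of tree | Twist of nat.

Fixpoint encode_tree T : GenTree.tree nat :=
  match T with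
  | One => GenTree.Node 0 [::]
  | Mult L R => GenTree.Node 1 [:: encode_tree L; encode_tree R]
  | Fun T => GenTree.Node 2 [:: encode_tree T]
  | Twist b => GenTree.Leaf b
  end.

Fixpoint decode_tree (c : GenTree.tree nat) : option tree :=
  match c with
  | GenTree.Node 0 _ => Some One
  | GenTree.Node 1 [:: l; r] =>
      if (decode_tree l, decode_tree r) is (Some L, Some R) then Some (Mult L R) else None
  | GenTree.Node _ [:: c] => omap Fun (decode_tree c)
  | GenTree.Leaf b => Some (Twist b)
  | _ => None
  end.

Lemma encode_treeK : pcancel encode_tree decode_tree.
Proof. by elim=> [|L /= -> R /= ->|T /= ->|]. Qed.

HB.instance Definition _ := Countable.copy tree (pcan_type encode_treeK).

Fixpoint tree_out (T : tree) : colour :=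
  match T with
  | One => (0, 1, 0)
  | Mult L R => ((tree_out L).1.1, (tree_out L).1.2 + (tree_out R).1.2, (tree_out R).2)
  | Fun T => ((tree_out T).1.1.+1, (tree_out T).1.2, (tree_out T).2.+1)
  | Twist b => (b.+2, 0, b.+1)
  end.

Fixpoint tree_size (T : tree) : nat :=
  match T with
  | One => 0
  | Mult L R => (tree_size L + tree_size R).+1
  | Fun T => (tree_size T).+1
  | Twist _ => 1
  end.

Fixpoint tree_mults (T : tree) : nat :=
  match T with
  | One | Twist _ => 0
  | Mult L R => (tree_mults L + tree_mults R).+1
  | Fun T => tree_mults T
  end.

(** The only typing constraint left on trees: the two upper boxes of a product fit
    next to each other. *)
Fixpoint matching (T : tree) : bool :=
  match T with
  | One | Twist _ => true
  | Mult L R => [&& matching L, matching R & (tree_out L).2 == (tree_out R).1.1]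
  | Fun T => matching T
  end.

(** The standard order term of a tree, with boxes numbered from [i] on and every
    identity filled up with [eta]. *)
Fixpoint tree_term (i : nat) (T : tree) : term :=
  match T with
  | One => Eta
  | Mult L R =>
    let: (p0, q1, p1) := tree_out L in
    let: (_, q2, p2) := tree_out R in
    App (Gen 0 0 p0 [:: (q1, p1); (q2, p2)])
      [:: Var i (0, 2, 0); tree_term i.+1 L; tree_term (i.+1 + tree_size L) R]
  | Fun T =>
    let: (p0, q1, p1) := tree_out T in
    App (Gen 1 1 p0 [:: (q1, p1)]) [:: Var i (1, 1, 1); tree_term i.+1 T]
  | Twist b => App (Gen 2 1 b [::]) [:: Var i (2, 0, 1)]
  end.

Definition gs_colours : seq colour := [:: (0, 2, 0); (1, 1, 1); (2, 0, 1)].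

Lemma out_tree_term i T : out (tree_term i T) = tree_out T.
Proof.
case: T => [|L R|T|b] //=.
  by case: (tree_out L) (tree_out R) => [[p0 q1] p1] [[p q2] p2] /=; rewrite /gout /= addn0.
by case: (tree_out T) => [[p0 q1] p1] /=; rewrite /gout /= addn0.
Qed.

Lemma leaves_tree_term i T :
  [/\ unzip1 (leaves (tree_term i T)) = iota i (tree_size T),
      all (mem gs_colours) (unzip2 (leaves (tree_term i T))) &
      outgoing (leaves (tree_term i T)) + tree_mults T = tree_size T].
Proof.
elim: T i => [|L IHL R IHR|T IH|b] i //=; last first.
  case: (tree_out T) => [[p0 q1] p1] /=; rewrite cats0.
  by have [-> -> /= <-] := IH i.+1.
case: (tree_out L) (tree_out R) => [[p0 q1] p1] [[p q2] p2] /=; rewrite cats0.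
have [eL aL oL] := IHL i.+1; have [eR aR oR] := IHR (i.+1 + tree_size L).
rewrite /unzip1 /unzip2 !map_cat !iotaD -/unzip1 -/unzip2 all_cat eL eR aL aR; split=> //.
rewrite -cat1s !outgoing_cat -[outgoing [:: _]]/0; lia.
Qed.

Lemma nboxes_tree_term i T : nboxes (tree_term i T) = tree_size T.
Proof.
by have [e _ _] := leaves_tree_term i T; rewrite /nboxes -(size_map fst) [map _ _]e size_iota.
Qed.

Lemma typed_tree_term i T : typed (tree_term i T) = matching T.
Proof.
elim: T i => [|L IHL R IHR|T IH|b] i //=; last first.
  have := out_tree_term i.+1 T; case: (tree_out T) => [[p0 q1] p1] E /=.
  by rewrite E IH /gin /= eqxx andbT.
have := out_tree_term i.+1 L; have := out_tree_term (i.+1 + tree_size L) R.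
case: (tree_out L) (tree_out R) => [[p0 q1] p1] [[p q2] p2] ER EL /=.
rewrite ER EL IHL IHR /gin /= andbT !eqseq_cons !xpair_eqE !eqxx /= !andbT [RHS]andbA andbC.
by rewrite eq_sym.
Qed.

Lemma std_tree_term i T : std i (tree_term i T).
Proof.
elim: T i => [|L IHL R IHR|T IH|b] i /=; try by do 2?constructor.
  case: (tree_out L) (tree_out R) => [[p0 q1] p1] [[p q2] p2].
  apply/std_app/std_cons; first exact: IHL.
  by rewrite nboxes_tree_term; apply: std_cons; [exact: IHR | exact: std_nil].
by case: (tree_out T) => [[p0 q1] p1]; apply/std_app/std_cons; [exact: IH | exact: std_nil].
Qed.

Lemma wf_tree_term T : matching T -> wf (tree_term 0 T).
Proof.
move=> mT; rewrite /wf typed_tree_term mT nboxes_tree_term.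
by have [-> _ _] := leaves_tree_term 0 T; apply: perm_refl.
Qed.

Definition quadratic_trees : seq tree :=
  [:: Mult (Mult One One) One; Mult One (Mult One One);
      Fun (Mult One One); Mult (Fun One) (Fun One);
      Mult (Fun (Fun One)) (Twist 0); Mult (Twist 0) (Fun One);
      Mult (Fun (Twist 0)) (Twist 0); Mult (Twist 1) (Twist 0)].

(** Without products a tree is a chain of restrictions ending in [One] or in a twist;
    it is then determined by its number of outputs up to finitely many choices. *)
Section MultFree.
Variable T : tree.
Hypothesis T0 : tree_mults T = 0.

Lemma mult_free_out : (tree_out T).1.1 + (tree_out T).1.2 = (tree_out T).2.+1.
Proof. by elim: T T0 => //= [T' IH /IH <-|b]; lia. Qed.

Lemma mult_free0 : (tree_out T).2 = 0 -> T = One.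
Proof. by case: T T0. Qed.

Lemma mult_free1 : (tree_out T).2 = 1 -> T = Fun One \/ T = Twist 0.
Proof.
case: T T0 => //= [T'|b]; last by move=> _ [->]; right.
by case: T' => //= _ _; left.
Qed.

Lemma mult_free2 : (tree_out T).2 = 2 ->
  [\/ T = Fun (Fun One), T = Fun (Twist 0) | T = Twist 1].
Proof.
case: T T0 => //= [T'|b]; last by move=> _ [->]; constructor 3.
case: T' => //= [T'|b] T'0 [].
  by case: T' T'0 => //= _ _; constructor 1.
by move=> ->; constructor 2.
Qed.
End MultFree.

Lemma one_mult T : matching T -> tree_mults T = 1 -> (tree_out T).2 = 0 -> T = Mult One One.
Proof.
case: T => //= L R /and3P[_ _ /eqP m] [] /eqP; rewrite addn_eq0 => /andP[/eqP L0 /eqP R0] r0.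
have ER := mult_free0 R0 r0; rewrite ER /= in m *.
by rewrite (mult_free0 L0 m).
Qed.

(** The number of outputs of a product is that of its right factor, whereas a
    restriction adds one.  So the bound leaves at most one further product, or one
    output on the right; since the factors match, this also bounds the left factor. *)
Lemma quadratic_classification T : matching T ->
  tree_mults T + (tree_out T).2 <= 2 -> td (tree_out T) = 2%Z -> T \in quadratic_trees.
Proof.
have tdE X : td X = 2%Z ->
    if X.1.1 + X.2 == 0 then X.1.2 = 3 else X.1.1 + X.1.2 = X.2 + 2.
  by case: X => [[p q] r]; rewrite /td /thin addn_eq0 /=; case: ifP; lia.
move=> mT le2 /tdE; case: T mT le2 => [|L R|T'|b] //= mT le2 tdT.
- case/and3P: mT => mL mR /eqP m.
  have {le2}le1 : tree_mults L + tree_mults R + (tree_out R).2 <= 1 by lia.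
  have [LR0|] := eqVneq (tree_mults L + tree_mults R) 0.
    have L0 : tree_mults L = 0 by lia.
    have R0 : tree_mults R = 0 by lia.
    have [r0|] := eqVneq (tree_out R).2 0.
      have ER := mult_free0 R0 r0; rewrite ER /= in m tdT.
      by rewrite (mult_free0 L0 m) in tdT.
    move=> r1; have {}r1 : (tree_out R).2 = 1 by lia.
    have [ER|ER] := mult_free1 R0 r1; rewrite ER /= in m *.
      by have [->|->] := mult_free1 L0 m.
    by have [->|->|->] := mult_free2 L0 m.
  move=> LR1; have {LR1}[LR1 r0] : tree_mults L + tree_mults R = 1 /\ (tree_out R).2 = 0 by lia.
  have [R0|R1] := eqVneq (tree_mults R) 0.
    have ER := mult_free0 R0 r0; rewrite ER /= in m *.
    by rewrite (one_mult mL _ m) //; lia.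
  have ER : R = Mult One One by apply: one_mult => //; lia.
  by rewrite ER /= in m *; rewrite (@mult_free0 L) //; lia.
- have T'1 : tree_mults T' = 1.
    rewrite addSn addnS /= in tdT; have := @mult_free_out T'.
    case: (tree_mults T') le2 => [|[|n]] //; last by lia.
    by move=> _ /(_ erefl); lia.
  by rewrite (one_mult mT T'1) //; lia.
- by move: tdT; rewrite addSn; lia.
Qed.

(** * Invariants of the relations between terms *)

Lemma teq_out s t : teq s t -> out s = out t.
Proof.
elim=> {s t} // [s t u _ -> _ ->|p q r t _ ->|p n r t _ ->] //.
  by rewrite /= /gout /= addn0.
rewrite /= /gout /gpn /= /unzip1 /unzip2 !map_nseq sumn_nseq mul1n.
by rewrite (_ : last 0 _ = 0) ?addn0 //; elim: n.
Qed.

Lemma teq_leaves s t : teq s t -> perm_eq (leaves s) (leaves t).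
Proof.
elim=> {s t} [t||s t u _ st _|g ts ts' s t _ st|p q r t _ _|p n r t _ _|] //=.
- by move=> s t _; rewrite perm_sym.
- exact: perm_trans.
- by rewrite !map_cat !flatten_cat /= perm_cat2l perm_cat2r.
- by rewrite cats0.
- by rewrite map_nseq (_ : flatten _ = [::]) ?cats0 //; elim: n.
move=> g h g' x ws _ _ _; rewrite -catA perm_cat2l.
elim: ws => //= [[[h1 x1] ys] ws IH] /=; rewrite map_cat flatten_cat -!catA perm_cat2l.
by rewrite perm_catCA perm_cat2l.
Qed.

(** Composition in the non-symmetric operad of sequences of natural numbers: the
    sequence plugged into the [i]-th input is translated by the [i]-th entry. *)
Fixpoint graft (ds : seq nat) (dss : seq (seq nat)) : seq nat :=
  match ds, dss with
  | d :: ds', ds1 :: dss' => map (addn d) ds1 ++ graft ds' dss'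
  | _, _ => [::]
  end.

(** For every vertical input, the number of boxes crossed on the way to the output.
    If one forgets the horizontal ports, the relations between stackings become the
    axioms of a non-symmetric operad, and [graft] satisfies these. *)
Fixpoint depths (t : term) : seq nat :=
  match t with
  | Var _ X => nseq X.1.2 1
  | Eta => [:: 0]
  | App _ ts => let dss := map depths ts in graft (head [::] dss) (behead dss)
  end.

Lemma graft_shift d ds dss : graft (map (addn d) ds) dss = map (addn d) (graft ds dss).
Proof.
elim: ds dss => [|d1 ds IH] [|ds1 dss] //=; rewrite map_cat IH -map_comp; congr (_ ++ _).
by apply: eq_map => j /=; rewrite addnA.
Qed.

Lemma graft_cat ds ds' dss dss' : size ds = size dss ->
  graft (ds ++ ds') (dss ++ dss') = graft ds dss ++ graft ds' dss'.
Proof. by elim: ds dss => [|d ds IH] [|ds1 dss] //= [/IH ->]; rewrite catA. Qed.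

Lemma size_graft ds dss : size ds = size dss -> size (graft ds dss) = sumn (map size dss).
Proof.
by elim: ds dss => [|d ds IH] [|ds1 dss] //= [/IH e]; rewrite size_cat size_map e.
Qed.

Lemma chain_arities p0 l : [seq X.1.2 | X <- chain_colours p0 l] = unzip1 l.
Proof. by elim: l p0 => [|[q p] l IH] p0 //=; rewrite IH. Qed.

Lemma size_depths t : typed t -> size (depths t) = (out t).1.2.
Proof.
elim/term_ind_in: t => [i X _||g ts IH tyt] //=; first by rewrite size_nseq.
have [t [ts' [Ets ot ots tyt' tyts]]] := typed_app tyt; rewrite Ets /= in IH *.
have -> : unzip1 (gl g) = map size (map depths ts').
  rewrite -(chain_arities (gp0 g)) -ots -!map_comp; apply/eq_in_map => s sts /=.
  by rewrite IH ?inE ?sts ?orbT //; exact: (allP tyts).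
apply: size_graft; rewrite IH ?mem_head // ot size_map -(size_map out) ots.
by rewrite -(size_map (fun X : colour => X.1.2)) chain_arities /= size_map.
Qed.

Lemma size_chain p0 l : size (chain_colours p0 l) = size l.
Proof. by elim: l p0 => [|[q p] l IH] p0 //=; rewrite IH. Qed.

Lemma arity_typed g t ts : typed (App g (t :: ts)) -> (out t).1.2 = size ts.
Proof.
case/andP => /eqP[-> e] _; rewrite -(size_map out) e size_chain //.
Qed.

(** For associativity, [graft] must split its arguments at the right places, which
    is where typing enters, through [size_depths]. *)
Lemma teq_depths s t : teq s t -> depths s = depths t.
Proof.
elim=> {s t} [|||g ts ts' s t _ st|p q r t _ _|p n r t tyt ot|] //.
- by move=> s t u _ -> _ ->.
- by rewrite /= !map_cat /= st.
- by rewrite /= cats0 -[RHS]map_id; apply: eq_map.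
- have := size_depths tyt; rewrite ot /= map_nseq /= => <-.
  by elim: (depths t) => //= d ds ->; rewrite addn0.
move=> g h g' x ws lhs rhs tyl tyr _; rewrite /lhs /rhs /=.
have [_ [_ [[_ <-] _ _ _ tyw]]] := typed_app tyr.
have [_ [_ [[<- _] _ _ tyh _]]] := typed_app tyl.
have [_ [_ [[_ <-] _ _ _ tyx]]] := typed_app tyh.
elim: ws (depths x) tyw tyx {lhs rhs tyr tyl tyh} => [|[[h1 x1] ys] ws IH] [|d ds] //=.
case/andP => tyh1 /IH{}IH /andP[tyx1 /IH{}IH].
have sz : size (map (addn d) (depths x1)) = size (map depths ys).
  by rewrite !size_map size_depths // (arity_typed tyh1).
by rewrite map_cat (graft_cat _ _ sz) graft_shift IH.
Qed.

(** * Cells and composition in the Gerstenhaber-Schack box operad *)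

Local Open Scope ring_scope.
Local Open Scope quotient_scope.

Lemma inj_id (k : comPzRingType) (B : box_operations k) X (b : B X) : inj b X = b.
Proof. by rewrite /inj; case: eqP => // e; rewrite (eq_irrelevance e erefl). Qed.

Lemma inj_out (k : comPzRingType) (B : box_operations k) X (b : B X) Y : X <> Y -> inj b Y = 0.
Proof. by rewrite /inj; case: eqP. Qed.

Lemma inj0 (k : comPzRingType) (B : box_operations k) X : inj (0 : B X) = 0.
Proof.
apply: functional_extensionality_dep => Y; rewrite /inj; case: eqP => // e.
by case: Y / e.
Qed.

Section GS.
Variables (k : comPzRingType) (C : small_category) (A : quiver_on k C).

Lemma hom_cast_id (U : C) (X Y : qob A U) (h : qhom X Y) : hom_cast X Y h = h.
Proof.
rewrite /hom_cast; case: pselect => // e; case: pselect => // e'.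
by rewrite (Prop_irrelevance e erefl) (Prop_irrelevance e' erefl).
Qed.

(** The only casts that matter below come from the associativity of composition in
    the base category. *)
Lemma hom_cast_target (V U : C) (X : qob A U) (g g' : arr V U) (e : g = g')
    Z (h : qhom Z (res g X)) :
  hom_cast Z (res g' X) h = ecast g (qhom Z (res g X)) e h.
Proof. by case: g' / e; rewrite hom_cast_id. Qed.

Lemma hom_cast0 (U : C) (X Y X' Y' : qob A U) : hom_cast X' Y' (0 : qhom X Y) = 0.
Proof.
by have := hom_cast_linear X' Y' (-1) (0 : qhom X Y) 0; rewrite scaler0 addr0 scaleN1r addNr.
Qed.

Lemma cbox_ext X (b b' : cbox A X) :
  (forall d, shape X d -> cbox_val b d = cbox_val b' d) -> b = b'.
Proof.
move=> E; apply: val_inj; apply: functional_extensionality_dep => d.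
have [/E //|nd] := boolP (shape X d).
by rewrite /= (asboolP _ (cbox_valP b)).2 // (asboolP _ (cbox_valP b')).2.
Qed.

(** With at most two vertices a face is unique, so that the cells of the shapes that
    occur below are given by their simplex and their arrows. *)
Lemma face0 p f : face 0 p f -> f = [:: 0%N] /\ p = 0%N.
Proof. by case: f => [|i [|]] // /and4P[_ _ /= /eqP-> /eqP<-]. Qed.

Lemma face1 p f : face 1 p f -> f = [:: 0%N; p].
Proof. by case: f => [|i [|j [|]]] // /and4P[_ _ /= /eqP-> /eqP<-]. Qed.

Lemma cells020 (Q : cell A -> Prop) :
  (forall U (A0 A1 A2 : qob A U) (a : qhom A0 A1) (b : qhom A1 A2),
     Q (Cell (pnil U) [:: 0%N] (pcons a (pcons b (pnil A2))))) ->
  forall d, shape (0, 2, 0)%N d -> Q d.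
Proof.
move=> QQ [V U s f X Y x] /= /and3P[/eqP szs /face0[-> _] /eqP].
case: s X Y x szs => //= {V}U X Y x _.
case: x => // X1 X2 X3 a x; case: x a => // X4 X5 X6 b x.
by case: x b => // X7 b a _; exact: QQ.
Qed.

Lemma cells111 (Q : cell A -> Prop) :
  (forall V U (u : arr V U) (A0 A1 : qob A U) (a : qhom A0 A1),
     Q (Cell (pcons u (pnil U)) [:: 0; 1]%N (pcons a (pnil A1)))) ->
  forall d, shape (1, 1, 1)%N d -> Q d.
Proof.
move=> QQ [V U s f X Y x] /= /and3P[/eqP szs /face1 -> /eqP].
case: s X Y x szs => // {}V W {}U u s; case: s u => // {}U u X Y x _.
case: x => // X1 X2 X3 a x; case: x a => // {}X1 a _; exact: QQ.
Qed.

Lemma cells201 (Q : cell A -> Prop) :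
  (forall W V U (v : arr W V) (u : arr V U) (X : qob A U),
     Q (Cell (pcons v (pcons u (pnil U))) [:: 0; 2]%N (pnil X))) ->
  forall d, shape (2, 0, 1)%N d -> Q d.
Proof.
move=> QQ [V U s f X Y x] /= /and3P[/eqP szs /face1 -> /eqP].
case: s X Y x szs => // {}V W {}U v s; case: s v => // {}W V' {}U u s v.
case: s u v => // {}U u v X Y x _; case: x => // {}X _; exact: QQ.
Qed.

Lemma cells030 (Q : cell A -> Prop) :
  (forall U (A0 A1 A2 A3 : qob A U) (a : qhom A0 A1) (b : qhom A1 A2) (d : qhom A2 A3),
     Q (Cell (pnil U) [:: 0%N] (pcons a (pcons b (pcons d (pnil A3)))))) ->
  forall d, shape (0, 3, 0)%N d -> Q d.
Proof.
move=> QQ [V U s f X Y x] /= /and3P[/eqP szs /face0[-> _] /eqP].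
case: s X Y x szs => //= {V}U X Y x _.
case: x => // X1 X2 X3 a x; case: x a => // X4 X5 X6 b x; case: x b => // X7 X8 X9 d x.
by case: x d => // X10 d b a _; exact: QQ.
Qed.

Lemma cells121 (Q : cell A -> Prop) :
  (forall V U (u : arr V U) (A0 A1 A2 : qob A U) (a : qhom A0 A1) (b : qhom A1 A2),
     Q (Cell (pcons u (pnil U)) [:: 0; 1]%N (pcons a (pcons b (pnil A2))))) ->
  forall d, shape (1, 2, 1)%N d -> Q d.
Proof.
move=> QQ [V U s f X Y x] /= /and3P[/eqP szs /face1 -> /eqP].
case: s X Y x szs => // {}V W {}U u s; case: s u => // {}U u X Y x _.
case: x => // X1 X2 X3 a x; case: x a => // X4 X5 X6 b x.
by case: x b => // X7 b a _; exact: QQ.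
Qed.

Lemma cells211 (Q : cell A -> Prop) :
  (forall W V U (v : arr W V) (u : arr V U) (A0 A1 : qob A U) (a : qhom A0 A1),
     Q (Cell (pcons v (pcons u (pnil U))) [:: 0; 2]%N (pcons a (pnil A1)))) ->
  forall d, shape (2, 1, 1)%N d -> Q d.
Proof.
move=> QQ [V U s f X Y x] /= /and3P[/eqP szs /face1 -> /eqP].
case: s X Y x szs => // {}V W {}U v s; case: s v => // {}W V' {}U u s v.
case: s u v => // {}U u v X Y x _.
case: x => // X1 X2 X3 a x; case: x a => // {}X1 a _; exact: QQ.
Qed.

Lemma cells301 (Q : cell A -> Prop) :
  (forall T W V U (w : arr T W) (v : arr W V) (u : arr V U) (X : qob A U),
     Q (Cell (pcons w (pcons v (pcons u (pnil U)))) [:: 0; 3]%N (pnil X))) ->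
  forall d, shape (3, 0, 1)%N d -> Q d.
Proof.
move=> QQ [V U s f X Y x] /= /and3P[/eqP szs /face1 -> /eqP].
case: s X Y x szs => // {}V W {}U v s; case: s v => // {}W V' {}U u s v.
case: s u v => // {}V' U' {}U u s v w; case: s u v w => // {}U u v w X Y x _.
by case: x => // {}X _; exact: QQ.
Qed.

(** The unit axiom of the box operad for the three colours of [(m, f, c)]; on a cell
    both sides compute to the same component. *)
Lemma cbox_comp_unit020 (th : cbox A (0, 2, 0)%N) :
  cbox_comp (g := Gen 0 0 0 [:: (1, 0); (1, 0)]%N) th (cbox_unit A, (cbox_unit A, tt)) = th.
Proof.
by apply: cbox_ext; apply: cells020 => U A0 A1 A2 a b; rewrite /= big_seq1 hom_cast_id.
Qed.

Lemma cbox_comp_unit111 (th : cbox A (1, 1, 1)%N) :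
  cbox_comp (g := Gen 1 1 0 [:: (1, 0)]%N) th (cbox_unit A, tt) = th.
Proof.
by apply: cbox_ext; apply: cells111 => V U u A0 A1 a; rewrite /= big_seq1 hom_cast_id.
Qed.

Lemma cbox_comp_unit201 (th : cbox A (2, 0, 1)%N) :
  cbox_comp (g := Gen 2 1 0 [::]) th tt = th.
Proof.
by apply: cbox_ext; apply: cells201 => W V U v u X; rewrite /= big_seq1 hom_cast_id.
Qed.

Lemma cbox_val0 X (th : cbox A X) V U (s : simplex V U) f X0 X1 X2 X3
    (x : arrows A U X0 X1) (y : arrows A U X2 X3) :
  cbox_val th (Cell s f (pcat x (pcons (0 : qhom X1 X2) y))) = 0.
Proof.
have [ml _] := asboolP _ (cbox_valP th).
by have /= := ml V U s f _ _ _ _ x y (-1) 0 0; rewrite scaler0 addr0 scaleN1r addNr.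
Qed.

Let B := GS_box A.

Lemma eval_unit (a : nat -> Tot B) i T X :
  (T, X) \in [:: (Mult One One, (0, 2, 0)); (Fun One, (1, 1, 1)); (Twist 0, (2, 0, 1))]%N ->
  eval a (tree_term i T) = eval a (Var i X).
Proof.
rewrite !inE => /or3P[] /eqP[-> ->] /=; rewrite ?inj_id.
- exact: (congr1 (@inj k B (0, 2, 0)%N) (cbox_comp_unit020 _)).
- exact: (congr1 (@inj k B (1, 1, 1)%N) (cbox_comp_unit111 _)).
- exact: (congr1 (@inj k B (2, 0, 1)%N) (cbox_comp_unit201 _)).
Qed.

Variables (m : CGS A 0 2) (f : CGS A 1 1) (c : CGS A 2 0).
Let alpha : Tot B := GS_incl (m, f, c).

Lemma GS_incl020 : alpha (0, 2, 0)%N = m.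
Proof. by rewrite /alpha /= -[LHS]/(inj _ _ + inj _ _ + inj _ _) inj_id !inj_out ?addr0. Qed.
Lemma GS_incl111 : alpha (1, 1, 1)%N = f.
Proof. by rewrite /alpha /= -[LHS]/(inj _ _ + inj _ _ + inj _ _) inj_id !inj_out ?add0r ?addr0. Qed.
Lemma GS_incl201 : alpha (2, 0, 1)%N = c.
Proof. by rewrite /alpha /= -[LHS]/(inj _ _ + inj _ _ + inj _ _) inj_id !inj_out ?add0r. Qed.
Lemma GS_incl_out X : X \notin gs_colours -> alpha X = 0.
Proof.
rewrite !inE !negb_or => /and3P[/eqP X0 /eqP X1 /eqP X2].
rewrite /alpha /= -[LHS]/(inj _ _ + inj _ _ + inj _ _) !inj_out ?addr0 //; exact/nesym.
Qed.

(** For this tree and the next five every face that occurs factors in only one way, so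
    that each sum over factorisations has a single term. *)
Lemma eval_assocl U (A0 A1 A2 A3 : qob A U) (a : qhom A0 A1) (b : qhom A1 A2) (d : qhom A2 A3) :
  cbox_val (eval (fun=> alpha) (tree_term 0 (Mult (Mult One One) One)) (0, 3, 0)%N)
    (Cell (pnil U) [:: 0%N] (pcons a (pcons b (pcons d (pnil A3)))))
  = GS_m m (GS_m m a b) d.
Proof.
by rewrite /= !inj_id GS_incl020 /= !big_seq1 !hom_cast_id.
Qed.

Lemma eval_assocr U (A0 A1 A2 A3 : qob A U) (a : qhom A0 A1) (b : qhom A1 A2) (d : qhom A2 A3) :
  cbox_val (eval (fun=> alpha) (tree_term 0 (Mult One (Mult One One))) (0, 3, 0)%N)
    (Cell (pnil U) [:: 0%N] (pcons a (pcons b (pcons d (pnil A3)))))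
  = GS_m m a (GS_m m b d).
Proof. by rewrite /= !inj_id GS_incl020 /= !big_seq1 !hom_cast_id. Qed.

Lemma eval_fun_mult V U (u : arr V U) (A0 A1 A2 : qob A U) (a : qhom A0 A1) (b : qhom A1 A2) :
  cbox_val (eval (fun=> alpha) (tree_term 0 (Fun (Mult One One))) (1, 2, 1)%N)
    (Cell (pcons u (pnil U)) [:: 0; 1]%N (pcons a (pcons b (pnil A2))))
  = GS_f f u (GS_m m a b).
Proof. by rewrite /= !inj_id GS_incl020 GS_incl111 /= !big_seq1 !hom_cast_id. Qed.

Lemma eval_mult_fun V U (u : arr V U) (A0 A1 A2 : qob A U) (a : qhom A0 A1) (b : qhom A1 A2) :
  cbox_val (eval (fun=> alpha) (tree_term 0 (Mult (Fun One) (Fun One))) (1, 2, 1)%N)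
    (Cell (pcons u (pnil U)) [:: 0; 1]%N (pcons a (pcons b (pnil A2))))
  = GS_m m (GS_f f u a) (GS_f f u b).
Proof. by rewrite /= !inj_id GS_incl020 GS_incl111 /= !big_seq1 !hom_cast_id. Qed.

Lemma eval_fun_twist W V U (v : arr W V) (u : arr V U) (A0 A1 : qob A U) (a : qhom A0 A1) :
  cbox_val (eval (fun=> alpha) (tree_term 0 (Mult (Fun (Fun One)) (Twist 0))) (2, 1, 1)%N)
    (Cell (pcons v (pcons u (pnil U))) [:: 0; 2]%N (pcons a (pnil A1)))
  = GS_m m (GS_f f v (GS_f f u a)) (GS_c c u v A1).
Proof. by rewrite /= !inj_id GS_incl020 GS_incl111 GS_incl201 /= !big_seq1 !hom_cast_id. Qed.

Lemma eval_twist_fun W V U (v : arr W V) (u : arr V U) (A0 A1 : qob A U) (a : qhom A0 A1) :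
  cbox_val (eval (fun=> alpha) (tree_term 0 (Mult (Twist 0) (Fun One))) (2, 1, 1)%N)
    (Cell (pcons v (pcons u (pnil U))) [:: 0; 2]%N (pcons a (pnil A1)))
  = GS_m m (GS_c c u v A0) (GS_f f (comp u v) a).
Proof. by rewrite /= !inj_id GS_incl020 GS_incl111 GS_incl201 /= !big_seq1 !hom_cast_id. Qed.

(** On a 3-simplex there are two ways to factor the face [0 < 3] through two further
    steps.  For each of the last two trees the inner composite vanishes on one of
    them, because it cuts the simplex at the wrong vertex. *)
Lemma eval_res_twist T W V U (w : arr T W) (v : arr W V) (u : arr V U) (X : qob A U) :
  cbox_val (eval (fun=> alpha) (tree_term 0 (Mult (Fun (Twist 0)) (Twist 0))) (3, 0, 1)%N)
    (Cell (pcons w (pcons v (pcons u (pnil U)))) [:: 0; 3]%N (pnil X))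
  = GS_m m (GS_f f w (GS_c c u v X)) (GS_c c (comp u v) w X).
Proof.
rewrite /= !inj_id GS_incl020 GS_incl111 GS_incl201 /= !(big_cons, big_nil, addr0) !hom_cast_id.
rewrite -[RHS]addr0; congr (_ + _).
transitivity (hom_cast (res w (res v (res u X))) (res (comp (comp u v) w) X)
  (0 : qhom (res w (res v (res u X))) (res (comp u (comp v w)) X))); last exact: hom_cast0.
congr hom_cast; exact: (cbox_val0 m (pnil _) [:: 0%N] (pnil _) (pcons _ (pnil _))).
Qed.

Lemma eval_twist_twist T W V U (w : arr T W) (v : arr W V) (u : arr V U) (X : qob A U) :
  cbox_val (eval (fun=> alpha) (tree_term 0 (Mult (Twist 1) (Twist 0))) (3, 0, 1)%N)
    (Cell (pcons w (pcons v (pcons u (pnil U)))) [:: 0; 3]%N (pnil X))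
  = hom_cast _ _ (GS_m m (GS_c c v w (res u X)) (GS_c c u (comp v w) X)).
Proof.
rewrite /= !inj_id GS_incl020 GS_incl201 /= !(big_cons, big_nil, addr0) !hom_cast_id.
rewrite -[RHS]add0r; congr (_ + _).
exact: (cbox_val0 m (pnil _) [:: 0%N] (pnil _) (pcons _ (pnil _))).
Qed.
End GS.

(** * Composites with a vanishing component *)

Section Zero.
Variables (k : comPzRingType) (C : small_category) (A : quiver_on k C).

Fixpoint some_zero p0 l : boxes (fun X => cbox A X : lmodType k) p0 l -> Prop :=
  match l return boxes _ p0 l -> Prop with
  | [::] => fun=> False
  | (q, p) :: l' => fun ths => ths.1 = 0 \/ some_zero ths.2
  end.

(** Every pure tensor in [tens ths s f x] has one factor from each member of [ths], so
    a single vanishing member kills all summands. *)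
Lemma tens_zero (W : lmodType k) p0 l (ths : boxes (fun X => cbox A X : lmodType k) p0 l)
    V U (s : simplex V U) f X Y (x : arrows A U X Y) (F : forall Z, arrows A V (pull s X) Z -> W) :
  (forall X1 X2 X3 (u : arrows A V (pull s X) X1) (v : arrows A V X2 X3),
     F X3 (pcat u (pcons (0 : qhom X1 X2) v)) = 0) ->
  some_zero ths -> \sum_(z <- tens ths s f x) F _ (projT2 z) = 0.
Proof.
elim: l p0 ths s f X x F => [|[q p] l IH] p0 ths s f X x F F0 //=.
case: ths => th ths /= th0; case: (psplit q x) => M [x1 x2].
rewrite big_allpairs_dep /= big1 // => f12 _.
case: th0 => [-> |ths0].
  by rewrite big1 // => z _; apply: (F0 _ _ _ (pnil _)).
pose F' Z (u : arrows A V (pull (restr f12.1 s) M) Z) :=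
  F Z (pcons (cbox_val th (Cell s f12.1 x1)) u).
apply: (IH _ _ _ _ _ _ F') => // X1 X2 X3 u v.
exact: (F0 _ _ _ (pcons _ u)).
Qed.

Lemma cbox_comp0l g (ths : boxes (fun X => cbox A X : lmodType k) (gp0 g) (gl g)) :
  @cbox_comp k C A g 0 ths = 0.
Proof.
apply: cbox_ext => -[V U s f X Y x] _ /=; case: ifP => // _.
case: (psplit (gp g) s) => V' [s1 s2]; rewrite big1 // => y _; exact: hom_cast0.
Qed.

Lemma cbox_comp0r g th (ths : boxes (fun X => cbox A X : lmodType k) (gp0 g) (gl g)) :
  some_zero ths -> @cbox_comp k C A g th ths = 0.
Proof.
move=> ths0; apply: cbox_ext => -[V U s f X Y x] _ /=; case: ifP => // _.
case: (psplit (gp g) s) => V' [s1 s2].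
pose F Z (u : arrows A V' (pull s2 X) Z) := hom_cast (pull s X) (pull (restr f s) Y)
  (cbox_val th (Cell s1 (take (gr g).+1 f) u)).
apply: (@tens_zero _ _ _ ths _ _ s2 _ _ _ x F) ths0 => X1 X2 X3 u v.
by rewrite /F cbox_val0 hom_cast0.
Qed.

Let B := GS_box A.

Lemma box_args_zero p0 l ts (a : nat -> Tot B) t : map out ts = chain_colours p0 l ->
  t \in ts -> eval a t = 0 -> some_zero (box_args p0 l (map (eval a) ts)).
Proof.
move=> + + at0; elim: ts p0 l => [|t' ts IH] p0 [|[q p] l] //= [_ ots].
rewrite inE => /predU1P[<-|tts]; first by left; rewrite at0.
by right; apply: IH.
Qed.

(** Typing matters here: it guarantees that no argument of a generator is ignored. *)
Lemma eval_zero (a : nat -> Tot B) t i X :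
  typed t -> (i, X) \in leaves t -> a i X = 0 -> eval a t = 0.
Proof.
move=> + + a0; elim/term_ind_in: t => [j Y _|//|g ts IH tyt].
  by rewrite inE => /eqP[<- <-]; rewrite /= a0 inj0.
case/flatten_mapP => t tts it.
have [t1 [ts1 [Ets ot ots tyt1 tyts1]]] := typed_app tyt.
have tyt' : typed t by case/andP: tyt => _ /allP/(_ t tts).
have t0 := IH t tts tyt' it.
rewrite Ets in tts *; rewrite -(@inj0 k B (gout g)) /=; apply: (congr1 (@inj k B (gout g))).
move: tts; rewrite inE => /predU1P[Et|tts].
  by rewrite -Et t0; exact: cbox_comp0l.
by apply: cbox_comp0r; exact: box_args_zero t0.
Qed.

End Zero.

(** * Normal forms of stackings *)

Section Indiscernible.
Variables (k : comPzRingType) (B : box_operations k).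

(** Everything that enters [P_n] agrees for the two terms, including the signs and
    the graphs, on which equality of classes of terms gives no direct hold. *)
Record indiscernible (s t : term) : Prop := Indiscernible {
  indiscernible_teq : teq s t;
  indiscernible_leaves : leaves s = leaves t;
  indiscernible_sign : gens_sign s = gens_sign t;
  indiscernible_graph : horizontal s = horizontal t;
  indiscernible_eval : forall a : nat -> Tot B, eval a s = eval a t
}.

Lemma indiscernible_refl t : indiscernible t t.
Proof. by split=> //; exact: teq_refl. Qed.

Lemma indiscernible_trans s t u : indiscernible s t -> indiscernible t u -> indiscernible s u.
Proof.
case=> st1 st2 st3 st4 st5 [tu1 tu2 tu3 tu4 tu5].
split; [exact: teq_trans tu1|exact: etrans tu2|exact: etrans tu3|exact: etrans tu4|].
by move=> a; rewrite st5.
Qed.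

Lemma indiscernible_ctx g ts ts' s t : indiscernible s t ->
  indiscernible (App g (ts ++ s :: ts')) (App g (ts ++ t :: ts')).
Proof.
case=> st1 st2 st3 st4 st5; split; first exact: teq_ctx.
- by rewrite /= !map_cat /= st2.
- by rewrite /= !map_cat /= st3.
- by rewrite /= !map_cat /= st4.
by move=> a; rewrite /= !map_cat /= st5.
Qed.

Lemma indiscernible_out s t : indiscernible s t -> out s = out t.
Proof. by case=> /teq_out. Qed.

Lemma indiscernible_nboxes s t : indiscernible s t -> nboxes s = nboxes t.
Proof. by rewrite /nboxes => /indiscernible_leaves ->. Qed.

Lemma indiscernible_inputs s t : indiscernible s t -> inputs s = inputs t.
Proof. by rewrite /inputs => /indiscernible_leaves ->. Qed.

Lemma indiscernible_tdeg s t : indiscernible s t -> tdeg s = tdeg t.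
Proof. by rewrite /tdeg => st; rewrite (indiscernible_out st) (indiscernible_inputs st). Qed.

Lemma indiscernible_td_sign s t : indiscernible s t -> td_sign s = td_sign t.
Proof.
rewrite /td_sign /d_sign => st.
by rewrite (indiscernible_inputs st) (indiscernible_sign st) (indiscernible_leaves st).
Qed.

Lemma indiscernible_op_sign s t : indiscernible s t -> op_sign s = op_sign t.
Proof.
rewrite /op_sign => st.
by rewrite (indiscernible_inputs st) (indiscernible_tdeg st) (indiscernible_out st).
Qed.
End Indiscernible.

Lemma teq_unit_tree i T X :
  (T, X) \in [:: (Mult One One, (0, 2, 0)); (Fun One, (1, 1, 1)); (Twist 0, (2, 0, 1))]%N ->
  teq (tree_term i T) (Var i X).
Proof.
rewrite !inE => /or3P[] /eqP[-> ->].
- exact: (@teq_unitr 0 2 0 (Var i (0, 2, 0)%N)).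
- exact: (@teq_unitr 1 1 1 (Var i (1, 1, 1)%N)).
- exact: (@teq_unitr 2 0 1 (Var i (2, 0, 1)%N)).
Qed.

Scheme std_mut := Minimality for std Sort Prop
  with std_seq_mut := Minimality for std_seq Sort Prop.

Section Normal.
Variables (k : comPzRingType) (C : small_category) (A : quiver_on k C).
Let B := GS_box A.
Notation indiscernible := (indiscernible B).

Lemma indiscernible_unit i T X :
  (T, X) \in [:: (Mult One One, (0, 2, 0)); (Fun One, (1, 1, 1)); (Twist 0, (2, 0, 1))]%N ->
  indiscernible (Var i X) (tree_term i T).
Proof.
move=> TX; split; [exact/teq_sym/teq_unit_tree| | | |by move=> a; rewrite (eval_unit a i TX)];
  move: TX; rewrite !inE => /or3P[] /eqP[-> ->] //.
all: by rewrite /= /gen_sign unlock.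
Qed.

Definition normalizes i t := typed t -> all (mem gs_colours) (unzip2 (leaves t)) ->
  exists2 T, matching T & indiscernible t (tree_term i T).

Fixpoint normalizes_seq i ts : Prop :=
  if ts is t :: ts' then normalizes i t /\ normalizes_seq (i + nboxes t) ts' else True.

(** An identity is replaced by the same box with [eta] in all its vertical inputs;
    its generator contributes the sign [+1] and its graph is a single vertex. *)
Lemma std_normalizes i t : std i t -> normalizes i t.
Proof.
move: i t; apply: (std_mut (P0 := normalizes_seq)) => [i X|i|i g X ts _ IH|//|i t ts _ IH _ IHs];
  last by split.
- move=> _; rewrite /= andbT !inE => /or3P[] /eqP->.
  + by exists (Mult One One) => //; apply: indiscernible_unit.
  + by exists (Fun One) => //; apply: indiscernible_unit.
  + by exists (Twist 0) => //; apply: indiscernible_unit.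
- by exists One => //; exact: indiscernible_refl.
move=> tyt /=; rewrite !inE => /andP[gX all_gs].
have [_ [_ [[<- <-] /= EX Ets _ tyts]]] := typed_app tyt.
case: g EX Ets tyt => p r p0 l; rewrite /ghead /gar /= => EX Ets tyt.
case/or3P: gX EX => /eqP-> [ep esz er]; rewrite -{}ep -{}er in tyt *.
- case: l esz Ets {tyt} => [|[q1 p1] [|[q2 p2] []]] // _.
  case: ts IH all_gs tyts => [|t1 [|t2 []]] //= [n1 [n2 _]].
  rewrite cats0 /unzip2 map_cat all_cat => /andP[gs1 gs2] /and3P[ty1 ty2 _] [o1 o2].
  have [L mL iL] := n1 ty1 gs1; have [R mR iR] := n2 ty2 gs2.
  have oL : tree_out L = (p0, q1, p1) by rewrite -(out_tree_term i.+1) -(indiscernible_out iL).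
  have oR : tree_out R = (p1, q2, p2).
    by rewrite -(out_tree_term (i.+1 + nboxes t1)) -(indiscernible_out iR).
  have sL : nboxes t1 = tree_size L by rewrite (indiscernible_nboxes iL) nboxes_tree_term.
  exists (Mult L R); first by rewrite /= mL mR oL oR /=.
  rewrite /= oL oR -sL.
  apply: indiscernible_trans (indiscernible_ctx _ [:: _; _] [::] iR).
  exact: (indiscernible_ctx _ [:: _] [:: _] iL).
- case: l esz Ets {tyt} => [|[q1 p1] []] // _.
  case: ts IH all_gs tyts => [|t1 []] //= [n1 _].
  rewrite cats0 andbT => gs1 ty1 [o1].
  have [L mL iL] := n1 ty1 gs1.
  have oL : tree_out L = (p0, q1, p1) by rewrite -(out_tree_term i.+1) -(indiscernible_out iL).
  exists (Fun L) => //; rewrite /= oL; exact: (indiscernible_ctx _ [:: _] [::] iL).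
- case: l esz Ets {tyt} => // _; case: ts {IH all_gs tyts} => // _.
  exists (Twist p0) => //; exact: indiscernible_refl.
Qed.

End Normal.

(** * The operations as sums over trees *)

Lemma wf_eta : wf Eta. Proof. by []. Qed.

Definition tree_stacking (T : tree) : stacking :=
  \pi_stacking (insubd (WTerm wf_eta) (tree_term 0 T)).

Lemma term_ofP S : standard_order S ->
  exists w : wterm, [/\ term_of S = w, std 0 w & \pi_stacking w = S].
Proof.
move=> so; rewrite /term_of; case: pselect => // e.
by case: (cid e) => w /= [sw pw]; exists w.
Qed.

Lemma pi_teq (v w : wterm) : \pi_stacking v = \pi_stacking w <-> teq v w.
Proof.
split=> [/eqP|vw]; first by rewrite eqmodE => /asboolP.
by apply/eqP; rewrite eqmodE; apply/asboolP.
Qed.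

Lemma quadratic_matching T : T \in quadratic_trees -> matching T.
Proof. by apply/allP. Qed.

Lemma quadratic_degree T : T \in quadratic_trees ->
  (tree_mults T + (tree_out T).2 = 2)%N /\ td (tree_out T) = 2.
Proof.
move=> qT; have /allP/(_ T qT)/andP[/eqP-> /eqP->] // : all (fun T =>
  (tree_mults T + (tree_out T).2 == 2)%N && (td (tree_out T) == 2)) quadratic_trees by vm_compute.
Qed.

Lemma val_tree_stacking T : matching T ->
  val (insubd (WTerm wf_eta) (tree_term 0 T)) = tree_term 0 T.
Proof. by move=> mT; rewrite insubdK //; exact: wf_tree_term. Qed.

(** Only the two bracketings of a triple product share their boxes; their depths are
    [2, 2, 1] and [1, 2, 2]. *)
Lemma quadratic_trees_teq T T' : T \in quadratic_trees -> T' \in quadratic_trees ->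
  teq (tree_term 0 T) (tree_term 0 T') -> T = T'.
Proof.
move=> qT qT' TT'; have lv := teq_leaves TT'; have dp := teq_depths TT'.
have: all (fun T => all (fun T' =>
    perm_eq (leaves (tree_term 0 T)) (leaves (tree_term 0 T')) &&
    (depths (tree_term 0 T) == depths (tree_term 0 T')) ==> (T == T')) quadratic_trees)
  quadratic_trees by vm_compute.
by move=> /allP/(_ T qT)/allP/(_ T' qT'); rewrite lv dp eqxx => /eqP.
Qed.

(** All three colours have degree [1]. *)
Lemma tdeg_gs t : all (mem gs_colours) (unzip2 (leaves t)) ->
  tdeg t = td (out t) - (nboxes t)%:Z.
Proof.
have pin : perm_eq (inputs t) (unzip2 (leaves t)) by apply: perm_map; rewrite perm_sort.
have -> : nboxes t = size (unzip2 (leaves t)) by rewrite size_map.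
rewrite /tdeg (perm_big _ pin) /= => gs; congr (_ - _).
elim: (unzip2 (leaves t)) gs => [|X Xs IH]; first by rewrite big_nil.
rewrite big_cons /= => /andP[gX /IH ->].
have -> : td X = 1 by move: gX; rewrite !inE => /or3P[] /eqP->.
by rewrite -PoszD add1n.
Qed.

Lemma inputs_gs t : all (mem gs_colours) (unzip2 (leaves t)) -> ~~ has semi_thin (inputs t).
Proof.
move=> gs; rewrite /inputs -all_predC; apply/allP => X.
rewrite (perm_mem (perm_map snd (permEl (perm_sort _ _)))) => /(allP gs).
by rewrite !inE => /or3P[] /eqP->.
Qed.

Section Quadratic.
Variables (k : comPzRingType) (C : small_category) (A : quiver_on k C).
Let B := GS_box A.

(** The Euler bound turns the condition on components into the numerical hypothesis of
    the classification. *)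
Lemma quadratic_tree_of n S : thin_quadratic n S ->
  all (mem gs_colours) (unzip2 (leaves (term_of S))) ->
  exists2 T, T \in quadratic_trees &
    S = tree_stacking T /\ indiscernible B (term_of S) (tree_term 0 T).
Proof.
case=> so nb deg comps _ gs.
have [w [Ew sw pw]] := term_ofP so; rewrite Ew in nb deg comps gs *.
have /andP[tyw _] := wvalP w.
have [T mT wT] := std_normalizes A sw tyw gs.
exists T; last by split=> //; rewrite -pw; apply/pi_teq; rewrite val_tree_stacking //; case: wT.
apply: quadratic_classification => //.
  have := euler_bound tyw; rewrite nb comps (indiscernible_out wT) out_tree_term.
  have [_ _] := leaves_tree_term 0 T; rewrite -(indiscernible_leaves wT) -(nboxes_tree_term 0 T).
  by rewrite -(indiscernible_nboxes wT) nb; lia.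
by move: deg; rewrite tdeg_gs // nb (indiscernible_out wT) out_tree_term; lia.
Qed.

(** One inequality is the Euler bound.  For the other, every vertex besides the first
    (the isolated root) and the last is a neighbour of the last, and there are no
    wires. *)
Lemma ncomponents_quadratic T : T \in quadratic_trees ->
  ncomponents (tree_size T) (horizontal (tree_term 0 T)) = 2.
Proof.
move=> qT; have mT := quadratic_matching qT; apply/eqP; rewrite eqn_leq; apply/andP; split.
  have : all (fun T => let G := horizontal (tree_term 0 T) in
      [&& count (fun e => (e.1.1 == None) && (e.2.1 == None)) G == 0%N, (0 < tree_size T)%N &
       all (fun l => [|| l == 0%N, l == (tree_size T).-1 | hadj G l (tree_size T).-1])
         (iota 0 (tree_size T))]) quadratic_trees by vm_compute.
  move=> /allP/(_ T qT) /= /and3P[/eqP w0 n0 /allP cover].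
  rewrite /ncomponents w0 addn0.
  have lt : ((tree_size T).-1 < tree_size T)%N by rewrite prednK.
  apply: (@n_comp_le2 _ _ (Ordinal n0) (Ordinal lt)) => l.
  have := cover l; rewrite mem_iota ltn_ord => /(_ isT)/or3P[/eqP l0|/eqP l1|].
  3: by right; right.
    by left; apply: val_inj.
  by right; left; apply: val_inj.
have := euler_bound (t := tree_term 0 T); rewrite typed_tree_term mT => /(_ isT).
rewrite nboxes_tree_term out_tree_term.
have [_ _] := leaves_tree_term 0 T.
by have [] := quadratic_degree qT; lia.
Qed.

(** The representative of the class of a tree is some standard order term.  It has a
    normal form, which is quadratic since boxes and output are invariants, and hence
    is the given tree. *)
Lemma term_of_tree_stacking T : T \in quadratic_trees ->
  standard_order (tree_stacking T) /\ indiscernible B (term_of (tree_stacking T)) (tree_term 0 T).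
Proof.
move=> qT; have mT := quadratic_matching qT.
have so : standard_order (tree_stacking T).
  exists (insubd (WTerm wf_eta) (tree_term 0 T)); split=> //.
  by have /= -> := val_tree_stacking mT; exact: std_tree_term.
split=> //; have [w [-> sw /pi_teq]] := term_ofP so; have /= -> := val_tree_stacking mT => tw.
have /andP[tyw _] := wvalP w.
have [_ gsT oT] := leaves_tree_term 0 T.
have pl := teq_leaves tw.
have gs : all (mem gs_colours) (unzip2 (leaves w)) by rewrite (perm_all _ (perm_map snd pl)).
have [T' mT' wT'] := std_normalizes A sw tyw gs.
suff qT' : T' \in quadratic_trees.
  rewrite (quadratic_trees_teq qT qT') //.
  by apply: teq_trans (teq_sym tw) _; case: wT'.
have TT' : teq (tree_term 0 T) (tree_term 0 T').
  by apply: teq_trans (teq_sym tw) _; case: wT'.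
have pl' := teq_leaves TT'.
have oE : tree_out T' = tree_out T by rewrite -2!(out_tree_term 0) (teq_out TT').
have mE : tree_mults T' = tree_mults T.
  have := perm_size pl'; rewrite -/(nboxes _) -/(nboxes _) !nboxes_tree_term.
  have [_ _] := leaves_tree_term 0 T'.
  rewrite (_ : outgoing (leaves (tree_term 0 T')) = outgoing (leaves (tree_term 0 T))); last first.
    by apply/esym/perm_sumn/perm_map.
  by lia.
have [two tdT] := quadratic_degree qT.
by apply: quadratic_classification; rewrite // ?oE ?mE ?two.
Qed.

Definition tree_summand (a : Tot B) (T : tree) : Tot B :=
  sgn k (td_sign (tree_term 0 T)) *:
    (sgn k (op_sign (tree_term 0 T)) *: eval (fun=> a) (tree_term 0 T)).

(** The sum over all thin-quadratic stackings has finite support: outside the classes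
    of the eight trees some box has a colour in which [a] vanishes. *)
Lemma P_trees n (a : Tot B) Y : (forall X, X \notin gs_colours -> a X = 0) ->
  P n (fun=> a) Y =
  \sum_(T <- quadratic_trees | (tree_size T == n) && (tree_out T == Y)) tree_summand a T Y.
Proof.
move=> a0; rewrite /P.
set s := [seq T <- quadratic_trees | (tree_size T == n) && (tree_out T == Y)].
have sP T : T \in s -> [/\ T \in quadratic_trees, tree_size T = n & tree_out T = Y].
  by rewrite mem_filter => /andP[/andP[/eqP-> /eqP->] ->].
have inA T : T \in s ->
    thin_quadratic n (tree_stacking T) /\ out (term_of (tree_stacking T)) = Y.
  case/sP => qT Tn TY; have [so iT] := term_of_tree_stacking qT.
  rewrite (indiscernible_out iT) out_tree_term; split=> //.
  have [_ gs _] := leaves_tree_term 0 T.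
  split=> //.
  - by rewrite (indiscernible_nboxes iT) nboxes_tree_term.
  - rewrite (indiscernible_tdeg iT) tdeg_gs // out_tree_term nboxes_tree_term Tn; congr (_ - _).
    by have [_ ->] := quadratic_degree qT.
  - by rewrite (indiscernible_graph iT) -Tn ncomponents_quadratic.
  - by rewrite (indiscernible_inputs iT) inputs_gs.
rewrite (@fsbigE _ _ _ _ _ (map tree_stacking s)) /=.
- rewrite big_map big_mkcond -[RHS]big_filter -/s [LHS]big_seq [RHS]big_seq /=.
  apply: eq_bigr => T Ts.
  rewrite ifT; last by rewrite inE; exact: inA.
  have [qT _ _] := sP _ Ts; have [_ iT] := term_of_tree_stacking qT.
  by rewrite (indiscernible_td_sign iT) (indiscernible_op_sign iT) (indiscernible_eval iT).
- rewrite map_inj_in_uniq ?filter_uniq // => T T' /sP[qT _ _] /sP[qT' _ _] TT'.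
  apply: quadratic_trees_teq => //.
  by move/pi_teq: TT'; rewrite !val_tree_stacking ?quadratic_matching.
- by move=> _ /= /mapP[T Ts ->]; exact: inA.
move=> S [qS SY] Ss.
have [gs|/allPn[X /mapP[[i X'] iX /= ->] nX]] :=
  boolP (all (mem gs_colours) (unzip2 (leaves (term_of S)))).
  have [T qT [ST iT]] := quadratic_tree_of qS gs.
  case/negP: Ss; rewrite ST map_f // mem_filter qT andbT -(out_tree_term 0).
  rewrite -(indiscernible_out iT) SY eqxx andbT.
  by rewrite -(nboxes_tree_term 0) -(indiscernible_nboxes iT); apply/eqP; case: qS.
have [so _ _ _ _] := qS; have [w [Ew _ _]] := term_ofP so.
rewrite Ew in iX *; have /andP[tyw _] := wvalP w.
by rewrite (eval_zero tyw iX) ?a0 // !scaler0.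
Qed.
End Quadratic.

(** * The Maurer-Cartan equation *)

(** The sign of a tree in the Maurer-Cartan equation is made of the two signs in the
    definition of [P_n] and of [(-1)^{n(n+1)/2}]. *)
Definition total_parity (T : tree) : bool :=
  odd (`|td_sign (tree_term 0 T)| + `|op_sign (tree_term 0 T)| +
       (tree_size T * (tree_size T).+1)./2)%N.

Lemma quadratic_parities :
  map total_parity quadratic_trees = [:: true; false; false; true; true; false; false; true].
Proof.
rewrite /quadratic_trees /= /total_parity /td_sign /op_sign /tdeg /d_sign /= /gen_sign !unlock.
by vm_compute.
Qed.

Section MaurerCartan.
Variables (k : comPzRingType) (C : small_category) (A : quiver_on k C).
Let B := GS_box A.

Lemma maurer_cartan_sum (a : Tot B) Y : (forall X, X \notin gs_colours -> a X = 0) ->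
  \sum_(n \in [set n | (2 <= n)%N]%classic) (-1) ^+ ((n * n.+1)./2) *: P n (fun=> a) Y =
  \sum_(T <- quadratic_trees | tree_out T == Y)
    (-1) ^+ total_parity T *: eval (fun=> a) (tree_term 0 T) Y.
Proof.
move=> a0.
have size_in T : T \in quadratic_trees -> tree_size T \in [:: 2; 3; 4]%N.
  by move: T; apply/allP.
rewrite (@fsbigE _ _ _ _ _ [:: 2; 3; 4]%N) //=; first last.
- move=> n _ n234; rewrite P_trees // big_seq_cond big_pred0 ?scaler0 // => T.
  by apply/and3P => -[/size_in + /eqP E _]; rewrite E (negPf n234).
- by move=> n; rewrite /= !inE => /or3P[] /eqP->.
rewrite (eq_bigl (fun n => (1 < n)%N)); last by move=> n; apply/idP/idP; rewrite in_setE.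
under eq_bigr do rewrite P_trees // scaler_sumr.
rewrite (exchange_big_dep (fun T => tree_out T == Y)) /=; last by move=> n T _ /andP[].
rewrite big_seq_cond [RHS]big_seq_cond; apply: eq_bigr => T /andP[/size_in sT TY].
transitivity ((-1) ^+ ((tree_size T * (tree_size T).+1)./2) *: tree_summand a T Y).
  rewrite (eq_bigl (pred1 (tree_size T))); last first.
    move=> n; rewrite /= TY andbT eq_sym; case: eqP => [->|]; last by rewrite andbF.
    by move: sT; rewrite !inE => /or3P[] /eqP->.
  by move: sT; rewrite !inE => /or3P[] /eqP->; rewrite !big_cons big_nil /= ?addr0 ?add0r.
rewrite /tree_summand -[(_ *: (_ *: eval _ _)) Y]/(_ *: (_ *: eval _ _ Y)) !scalerA.
by rewrite /sgn -!exprD addnC signr_odd.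
Qed.

Variables (m : CGS A 0 2) (f : CGS A 1 1) (c : CGS A 2 0).
Let alpha : Tot B := GS_incl (m, f, c).
Let ev T Y := eval (fun=> alpha) (tree_term 0 T) Y.

(** In each of the four colours two trees contribute, with opposite signs; in all other
    colours the equation is void. *)
Lemma maurer_cartan_trees : maurer_cartan alpha <->
  [/\ ev (Mult (Mult One One) One) (0, 3, 0)%N = ev (Mult One (Mult One One)) (0, 3, 0)%N,
      ev (Fun (Mult One One)) (1, 2, 1)%N = ev (Mult (Fun One) (Fun One)) (1, 2, 1)%N,
      ev (Mult (Fun (Fun One)) (Twist 0)) (2, 1, 1)%N = ev (Mult (Twist 0) (Fun One)) (2, 1, 1)%N &
      ev (Mult (Fun (Twist 0)) (Twist 0)) (3, 0, 1)%N = ev (Mult (Twist 1) (Twist 0)) (3, 0, 1)%N].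
Proof.
have homo : homogeneous 1 alpha.
  move=> X td1; apply: GS_incl_out; apply/negP; rewrite !inE => /or3P[] /eqP EX;
  by rewrite EX in td1.
have sumE Y := maurer_cartan_sum Y (@GS_incl_out _ _ _ m f c).
have [p1 p2 p3 p4 p5 p6 p7 p8] := quadratic_parities.
(* the two members of a pair come with opposite signs *)
have two (M : lmodType k) (x y : M) : -1 *: x + y = 0 <-> x = y.
  by rewrite scaleN1r addrC; split=> [/eqP|->]; [rewrite subr_eq0 => /eqP-> | rewrite subrr].
split=> [[_ mc]|[e1 e2 e3 e4]].
  have {mc}:= (mc (0, 3, 0)%N, mc (1, 2, 1)%N, mc (2, 1, 1)%N, mc (3, 0, 1)%N).
  rewrite !sumE /quadratic_trees !(big_cons, big_nil) /= !(p1, p2, p3, p4, p5, p6, p7, p8).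
  rewrite expr0 expr1 !addr0 !scale1r => -[[[mc1 mc2] mc3] mc4]; split.
  + exact/two.
  + by move: mc2; rewrite addrC => /two.
  + exact/two.
  + by move: mc4; rewrite addrC => /two.
split=> // Y; rewrite sumE.
have [->|n1] := eqVneq Y (0, 3, 0)%N.
  rewrite /quadratic_trees !(big_cons, big_nil) /= p1 p2 expr0 expr1 addr0 scale1r.
  exact/two.
have [->|n2] := eqVneq Y (1, 2, 1)%N.
  rewrite /quadratic_trees !(big_cons, big_nil) /= p3 p4 expr0 expr1 addr0 scale1r addrC.
  exact/two.
have [->|n3] := eqVneq Y (2, 1, 1)%N.
  rewrite /quadratic_trees !(big_cons, big_nil) /= p5 p6 expr0 expr1 addr0 scale1r.
  exact/two.
have [->|n4] := eqVneq Y (3, 0, 1)%N.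
  rewrite /quadratic_trees !(big_cons, big_nil) /= p7 p8 expr0 expr1 addr0 scale1r addrC.
  exact/two.
have outs T : T \in quadratic_trees ->
    tree_out T \in [:: (0, 3, 0); (1, 2, 1); (2, 1, 1); (3, 0, 1)]%N.
  by move: T; apply/allP.
rewrite big_seq_cond big_pred0 // => T; apply/andP => -[/outs + /eqP E]; rewrite E.
by rewrite !inE (negPf n1) (negPf n2) (negPf n3) (negPf n4).
Qed.

Lemma associativity_iff :
  ev (Mult (Mult One One) One) (0, 3, 0)%N = ev (Mult One (Mult One One)) (0, 3, 0)%N <->
  forall U (A0 A1 A2 A3 : qob A U) (a : qhom A0 A1) (b : qhom A1 A2) (d : qhom A2 A3),
    GS_m m (GS_m m a b) d = GS_m m a (GS_m m b d).
Proof.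
split=> [E U A0 A1 A2 A3 a b d|E].
  by rewrite -(eval_assocl m f c) -(eval_assocr m f c) -/(ev _ _) E.
apply: cbox_ext; apply: cells030 => U A0 A1 A2 A3 a b d.
apply: etrans (eval_assocl m f c a b d) _.
exact: etrans (E _ _ _ _ _ a b d) (esym (eval_assocr m f c a b d)).
Qed.

Lemma functoriality_iff :
  ev (Fun (Mult One One)) (1, 2, 1)%N = ev (Mult (Fun One) (Fun One)) (1, 2, 1)%N <->
  forall V U (u : arr V U) (A0 A1 A2 : qob A U) (a : qhom A0 A1) (b : qhom A1 A2),
    GS_f f u (GS_m m a b) = GS_m m (GS_f f u a) (GS_f f u b).
Proof.
split=> [E V U u A0 A1 A2 a b|E].
  by rewrite -(eval_fun_mult m f c) -(eval_mult_fun m f c) -/(ev _ _) E.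
apply: cbox_ext; apply: cells121 => V U u A0 A1 A2 a b.
apply: etrans (eval_fun_mult m f c u a b) _.
exact: etrans (E _ _ u _ _ _ a b) (esym (eval_mult_fun m f c u a b)).
Qed.

Lemma naturality_iff :
  ev (Mult (Fun (Fun One)) (Twist 0)) (2, 1, 1)%N = ev (Mult (Twist 0) (Fun One)) (2, 1, 1)%N <->
  forall W V U (v : arr W V) (u : arr V U) (A0 A1 : qob A U) (a : qhom A0 A1),
    GS_m m (GS_f f v (GS_f f u a)) (GS_c c u v A1) = GS_m m (GS_c c u v A0) (GS_f f (comp u v) a).
Proof.
split=> [E W V U v u A0 A1 a|E].
  by rewrite -(eval_fun_twist m f c) -(eval_twist_fun m f c) -/(ev _ _) E.
apply: cbox_ext; apply: cells211 => W V U v u A0 A1 a.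
apply: etrans (eval_fun_twist m f c v u a) _.
exact: etrans (E _ _ _ v u _ _ a) (esym (eval_twist_fun m f c v u a)).
Qed.

(** The two composites end in restrictions along [(u v) w] and along [u (v w)], hence
    the transport along associativity. *)
Lemma coherence_iff :
  ev (Mult (Fun (Twist 0)) (Twist 0)) (3, 0, 1)%N = ev (Mult (Twist 1) (Twist 0)) (3, 0, 1)%N <->
  forall T W V U (u : arr V U) (v : arr W V) (w : arr T W) (X : qob A U),
    GS_m m (GS_f f w (GS_c c u v X)) (GS_c c (comp u v) w X)
    = ecast g (qhom (res w (res v (res u X))) (res g X)) (compA u v w)
        (GS_m m (GS_c c v w (res u X)) (GS_c c u (comp v w) X)).
Proof.
split=> [E T W V U u v w X|E].
  rewrite -(hom_cast_target (compA u v w)) -(eval_twist_twist m f c).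
  by rewrite -(eval_res_twist m f c) -/(ev _ _) E.
apply: cbox_ext; apply: cells301 => T W V U w v u X.
apply: etrans (eval_res_twist m f c w v u X) (etrans (E _ _ _ _ u v w X) _).
by apply: etrans (esym (eval_twist_twist m f c w v u X)); rewrite -hom_cast_target.
Qed.
End MaurerCartan.

(** * Lax prestacks *)

Lemma GS_m_linearl (k : comPzRingType) (C : small_category) (A : quiver_on k C) (m : CGS A 0 2)
    U (A0 A1 A2 : qob A U) (t : k) (a a' : qhom A0 A1) (b : qhom A1 A2) :
  GS_m m (t *: a + a') b = t *: GS_m m a b + GS_m m a' b.
Proof.
have [ml _] := asboolP _ (cbox_valP m).
exact: (ml U U (pnil U) [:: 0%N] _ _ _ _ (pnil A0) (pcons b (pnil A2)) t a a').
Qed.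

Lemma GS_m_linearr (k : comPzRingType) (C : small_category) (A : quiver_on k C) (m : CGS A 0 2)
    U (A0 A1 A2 : qob A U) (t : k) (a : qhom A0 A1) (b b' : qhom A1 A2) :
  GS_m m a (t *: b + b') = t *: GS_m m a b + GS_m m a b'.
Proof.
have [ml _] := asboolP _ (cbox_valP m).
exact: (ml U U (pnil U) [:: 0%N] _ _ _ _ (pcons a (pnil A1)) (pnil A2) t b b').
Qed.

Lemma GS_f_linear (k : comPzRingType) (C : small_category) (A : quiver_on k C) (f : CGS A 1 1)
    V U (u : arr V U) (A0 A1 : qob A U) (t : k) (a a' : qhom A0 A1) :
  GS_f f u (t *: a + a') = t *: GS_f f u a + GS_f f u a'.
Proof.
have [ml _] := asboolP _ (cbox_valP f).
exact: (ml V U (pcons u (pnil U)) [:: 0; 1]%N _ _ _ _ (pnil A0) (pnil A1) t a a').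
Qed.

Theorem theorem4p10 (k : comPzRingType) (C : small_category) (A : quiver_on k C)
    (m : CGS A 0 2) (f : CGS A 1 1) (c : CGS A 2 0) :
  maurer_cartan (GS_incl (m, f, c)) <-> is_lax_prestack (GS_m m) (GS_f f) (GS_c c).
Proof.
split=> [/maurer_cartan_trees[]|].
  move=> /associativity_iff ass /functoriality_iff fct /naturality_iff nat /coherence_iff coh.
  split=> //.
  - move=> U; split=> *; [exact: GS_m_linearl | exact: GS_m_linearr | exact: ass].
  - by move=> V U u; split=> *; [exact: GS_f_linear | exact: fct].
  - by move=> W V U u v A0 A1 a; exact: nat.
case=> cat rst twist coh; apply/maurer_cartan_trees; split.
- by apply/associativity_iff => U; have [] := cat U.
- by apply/functoriality_iff => V U u; have [_] := rst V U u.
- by apply/naturality_iff => W V U v u; exact: twist.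
- by apply/coherence_iff.
Qed.
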